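(* There is an absolute constant $c > 0$ such that the following holds. Let $A$ be an $N \times n$ random matrix whose rows $A_1,\dots,A_N$ are independent isotropic random vectors in $\mathbb{R}^n$. Let $m$ be a number such that $\|A_i\|_2 \le \sqrt{m}$ almost surely for all $i$. Then for every $t \ge 0$, one has $$\sqrt{N} - t\sqrt{m} \le s_{\min}(A) \le s_{\max}(A) \le \sqrt{N} + t\sqrt{m}$$ with probability at least $1 - 2n\cdot\exp(-ct^2)$.
   Context: All matrices are real. For an $N \times n$ matrix $A$, the singular values $s_1(A) \ge \dots \ge s_n(A) \ge 0$ are the eigenvalues of $\sqrt{A^*A}$; $s_{\max}(A) = s_1(A)$ and $s_{\min}(A) = s_n(A)$ (so $s_{\min}(A)=0$ if $N<n$). A random vector $X$ in $\mathbb{R}^n$ is isotropic if $\mathbb{E}\, XX^T = I$, equivalently $\mathbb{E}\langle X,x\rangle^2 = \|x\|_2^2$ for all $x \in \mathbb{R}^n$ (no centering is assumed). *)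

(* Defs.v *)
From HB Require Import structures.
From mathcomp Require Import all_boot all_order all_algebra.
From mathcomp Require Import all_classical all_reals all_analysis.
Set Implicit Arguments.
Unset Strict Implicit.
Unset Printing Implicit Defensive.
Import Order.TTheory GRing.Theory Num.Theory.
Import numFieldNormedType.Exports.
Local Open Scope classical_set_scope.
Local Open Scope ring_scope.

Definition psdmx (R : realType) (n : nat) (B : 'M[R]_n) : Prop :=
  B^T = B /\ forall x : 'rV[R]_n, 0 <= (x *m B *m x^T) 0 0.

(* The positive semidefinite square root; it exists and is unique when M is
   itself positive semidefinite, in particular for M = A^T *m A. *)
Definition sqrtmx (R : realType) (n : nat) (M : 'M[R]_n) : 'M[R]_n :=
  xget 0 [set B : 'M[R]_n | psdmx B /\ B *m B = M].

(* With multiplicity, in nonincreasing order; [:: ] if the characteristic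
   polynomial does not split over R (it does when M is symmetric). *)
Definition eigenvalues (R : realType) (n : nat) (M : 'M[R]_n) : seq R :=
  xget [::] [set s : seq R | sorted >=%R s /\
                             char_poly M = \prod_(a <- s) ('X - a%:P)].

Definition singular_values (R : realType) (N n : nat) (A : 'M[R]_(N, n)) :
  seq R := eigenvalues (sqrtmx (A^T *m A)).

(* Indices start at 0: s_1(A) is item 0 and s_n(A) is item n.-1. *)
Definition s_max (R : realType) (N n : nat) (A : 'M[R]_(N, n)) : R :=
  (singular_values A)`_0.

Definition s_min (R : realType) (N n : nat) (A : 'M[R]_(N, n)) : R :=
  (singular_values A)`_n.-1.

(* The library's norm `|x| on 'rV[R]_n is the sup norm. *)
Definition norm2 (R : realType) (n : nat) (x : 'rV[R]_n) : R :=
  Num.sqrt (\sum_(j < n) x 0 j ^+ 2).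

(* R^n with its Borel sigma-algebra; vectors are rows. *)
Notation borel_rV R n := (g_sigma_algebraType (@open 'rV[R]_n)).

Definition random_vector (R : realType) (d : measure_display)
    (T : measurableType d) (n : nat) (X : T -> borel_rV R n) : Prop :=
  measurable_fun [set: T] X.

Definition mutually_independent (R : realType) (d : measure_display)
    (T : measurableType d) (P : probability T R) (I : finType)
    (d' : measure_display) (U : measurableType d') (X : I -> T -> U) : Prop :=
  forall (J : {set I}) (B : I -> set U),
    (forall i, i \in J -> measurable (B i)) ->
    P (\bigcap_(i in [set` J]) X i @^-1` B i) =
      (\prod_(i in J) P (X i @^-1` B i))%E.

(* E X X^T = I; since X is a row here, X X^T is written X^T *m X. *)
Definition isotropic (R : realType) (d : measure_display)
    (T : measurableType d) (P : probability T R) (n : nat)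
    (X : T -> 'rV[R]_n) : Prop :=
  forall j k : 'I_n,
    ('E_P[fun w => ((X w)^T *m X w) j k] = ((1%:M : 'M[R]_n) j k)%:E)%E.

(* Main.v *)
Require Import Defs.
From HB Require Import structures.
From mathcomp Require Import all_boot all_order all_algebra.
From mathcomp Require Import all_classical all_reals all_analysis.
From mathcomp Require Import measurable_realfun complex ring lra.
Set Implicit Arguments.
Unset Strict Implicit.
Unset Printing Implicit Defensive.
Import Order.TTheory GRing.Theory Num.Theory.
Import numFieldNormedType.Exports.
Local Open Scope classical_set_scope.
Local Open Scope ring_scope.

(* Write S = A^T A as the sum of the rank-one matrices v_i^T v_i, v_i the rows.
   The bounds on the singular values say that S lies between
   (sqrt N - t sqrt m)^2 and (sqrt N + t sqrt m)^2, and each side is the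
   Laplace transform method with the exponential replaced by a large power:
   one follows E tr K^p along K = C + v_1^T v_1 + ... + v_k^T v_k (upper bound)
   and K = C - v_1^T v_1 - ... - v_k^T v_k (lower bound), for C = p / theta
   and p large.  The Golden-Thompson inequality is only needed for rank-one
   perturbations, where it reduces to the inequality
   phi(i) phi(j) <= phi(0) phi(i + j) for phi(k) = v K^k v^T, a log-convex
   sequence by Cauchy-Schwarz.  Isotropy and independence of v and K turn
   E v K^q v^T into E tr K^q, so E tr K^p grows at most geometrically in k. *)

(** * Quadratic forms *)

(** Matrix exponentials do not multiply, so independence cannot be applied to E tr exp(theta S)
    directly. With C = (p + 1) / theta the matrix (1 + S / C)^(p+1) approximates exp(theta S), and
    its entries are polynomials in the coordinates of the rows: independence is then only needed for
    finite products of bounded functions.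

    For large p the exponent of either tail is at most -t^2/4; a finite p costs up to t^2/8 of it,
    which leaves the constant 1/8. The lower bound needs C - S to stay positive, hence C > N m,
    which is harmless because p is free.

    The rows are bounded only almost surely, so moments are computed for truncated rows. Events on
    singular values are rewritten as semidefiniteness of a scalar minus A^T A, or the reverse; in
    that form measurability and the passage from truncated to true rows are easy. *)

Section LogConvexSequences.
Variables (R : realFieldType) (c : R) (phi : nat -> R).
Hypotheses (c_gt0 : 0 < c) (phi0_gt0 : 0 < phi 0) (phi_ge0 : forall k, 0 <= phi k).
Hypothesis phi_step1 : c * phi 0 <= phi 1%N.
Hypothesis phi_logconvex : forall k, phi k.+1 ^+ 2 <= phi k * phi k.+2.

(** The lower bound on [phi 1] starts the induction; from there on, a zero term would force its
    predecessor to vanish. Strict positivity is what allows the cancellations below. *)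
Lemma logconvex_gt0 k : 0 < phi k.
Proof.
suff: 0 < phi k /\ 0 < phi k.+1 by case.
elim: k => [|k [k0 k1]]; split => //.
  by apply: lt_le_trans phi_step1; rewrite mulr_gt0.
rewrite lt_neqAle phi_ge0 andbT; apply/negP => /eqP k2.
have := phi_logconvex k; rewrite -k2 mulr0 leNgt.
by rewrite exprn_gt0.
Qed.

(** Log-convexity means that the ratio of consecutive terms grows with the index; cross-multiplying
    avoids division. *)
Lemma logconvex_ratio a b : (a <= b)%N -> phi a.+1 * phi b <= phi b.+1 * phi a.
Proof.
elim: b => [|b IH]; first by rewrite leqn0 => /eqP ->.
rewrite leq_eqVlt => /predU1P[-> //|]; rewrite ltnS => /IH {}IH.
rewrite -(ler_pM2r (logconvex_gt0 b)).
apply: (@le_trans _ _ (phi b.+1 ^+ 2 * phi a)).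
  rewrite expr2 -[leRHS]mulrA mulrAC [leLHS]mulrC.
  by rewrite ler_pM2l ?logconvex_gt0.
rewrite [leRHS]mulrAC [X in _ <= X * _]mulrC.
by rewrite ler_pM2r ?logconvex_gt0.
Qed.

(** Raising i by one multiplies the left side by the ratio at i and the right side by the ratio at i
    + j, which is at least as large. *)
Lemma logconvex_mul i j : phi i * phi j <= phi 0 * phi (i + j)%N.
Proof.
elim: i => [|i IH] //; rewrite -(ler_pM2r (logconvex_gt0 i)) addSn.
apply: (@le_trans _ _ (phi 0 * phi (i + j)%N * phi i.+1)).
  by rewrite mulrAC -mulrA mulrC ler_pM2r ?logconvex_gt0.
rewrite -!mulrA ler_pM2l // mulrC.
exact: logconvex_ratio (leq_addr _ _).
Qed.

Lemma logconvex_step k : c * phi k <= phi k.+1.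
Proof.
rewrite -(ler_pM2r phi0_gt0); apply: le_trans (logconvex_ratio (leq0n k)).
by rewrite mulrAC ler_pM2r ?logconvex_gt0.
Qed.

(** After division by [phi 0 ^+ k.+1] this is a Jensen inequality: each of the first k ratios is at
    least the one at 0. *)
Lemma logconvex_exp k : phi 1%N ^+ k * phi 0 <= phi k * phi 0 ^+ k.
Proof.
elim: k => [|k IH]; first by rewrite !expr0 mul1r mulr1.
rewrite !exprS -mulrA.
apply: (@le_trans _ _ (phi 1%N * (phi k * phi 0 ^+ k))).
  by rewrite ler_pM2l ?logconvex_gt0.
rewrite !mulrA ler_pM2r ?exprn_gt0 //.
exact: logconvex_ratio.
Qed.

End LogConvexSequences.

Section QuadraticForms.
Variables (R : realType) (n : nat).
Implicit Types (Q K L : 'M[R]_n) (x y v : 'rV[R]_n).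

Definition bform Q x y : R := (x *m Q *m y^T) 0 0.
Definition qform Q x : R := bform Q x x.
Definition sqnorm x : R := \sum_(j < n) x 0 j ^+ 2.

Lemma sqnormE x : sqnorm x = (x *m x^T) 0 0.
Proof. by rewrite mxE; apply: eq_bigr => j _; rewrite mxE expr2. Qed.

Lemma sqnorm_ge0 x : 0 <= sqnorm x.
Proof. by apply: sumr_ge0 => j _; rewrite sqr_ge0. Qed.

Lemma sqnorm_eq0 x : (sqnorm x == 0) = (x == 0).
Proof.
apply/eqP/eqP => [x0|->]; last by rewrite sqnormE mul0mx mxE.
apply/rowP => j; rewrite mxE; apply/eqP; rewrite -sqrf_eq0.
move/eqP: x0; rewrite psumr_eq0; last by move=> i _; rewrite sqr_ge0.
by move/allP/(_ j); apply; rewrite mem_index_enum.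
Qed.

Lemma sqnorm_gt0 x : (0 < sqnorm x) = (x != 0).
Proof. by rewrite lt_neqAle sqnorm_ge0 andbT eq_sym sqnorm_eq0. Qed.

Lemma bformDl Q x y z : bform Q (x + y) z = bform Q x z + bform Q y z.
Proof. by rewrite /bform !mulmxDl mxE. Qed.

Lemma bformDr Q x y z : bform Q z (x + y) = bform Q z x + bform Q z y.
Proof. by rewrite /bform linearD mulmxDr mxE. Qed.

Lemma bformZl Q a x y : bform Q (a *: x) y = a * bform Q x y.
Proof. by rewrite /bform -!scalemxAl mxE. Qed.

Lemma bformZr Q a x y : bform Q x (a *: y) = a * bform Q x y.
Proof. by rewrite /bform linearZ -scalemxAr mxE. Qed.

Lemma bformD Q K x y : bform (Q + K) x y = bform Q x y + bform K x y.
Proof. by rewrite /bform mulmxDr mulmxDl mxE. Qed.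

Lemma bformB Q K x y : bform (Q - K) x y = bform Q x y - bform K x y.
Proof. by rewrite /bform mulmxBr mulmxBl !mxE. Qed.

Lemma bformM Q K x y : bform (Q *m K) x y = bform K (x *m Q) y.
Proof. by rewrite /bform mulmxA. Qed.

Lemma bform_sym Q x y : Q^T = Q -> bform Q x y = bform Q y x.
Proof.
move=> sQ; rewrite /bform.
have <- : (x *m Q *m y^T)^T 0 0 = (x *m Q *m y^T) 0 0 by rewrite mxE.
by rewrite !trmx_mul trmxK sQ mulmxA.
Qed.

Lemma qform_scalar a x : qform a%:M x = a * sqnorm x.
Proof. by rewrite /qform /bform mul_mx_scalar -scalemxAl mxE sqnormE. Qed.

Lemma qform_gram N (A : 'M[R]_(N, n)) x :
  qform (A^T *m A) x = \sum_(i < N) (A *m x^T) i 0 ^+ 2.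
Proof.
rewrite /qform /bform mulmxA -mulmxA -{1}[x]trmxK -trmx_mul mxE.
by apply: eq_bigr => i _; rewrite mxE expr2.
Qed.

Lemma bform_cauchy_schwarz Q x y : psdmx Q ->
  bform Q x y ^+ 2 <= qform Q x * qform Q y.
Proof.
case=> sQ Q_ge0.
have key s t : 0 <= s ^+ 2 * qform Q x + 2 * (s * t * bform Q x y) + t ^+ 2 * qform Q y.
  suff -> : s ^+ 2 * qform Q x + 2 * (s * t * bform Q x y) + t ^+ 2 * qform Q y =
    bform Q (s *: x + t *: y) (s *: x + t *: y) by exact: Q_ge0.
  by rewrite /qform bformDl !bformDr !bformZl !bformZr (bform_sym y x sQ); ring.
set a := qform Q x in key *; set b := bform Q x y in key *.
set d := qform Q y in key *.
have d_ge0 : 0 <= d by exact: Q_ge0.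
have [d_eq0|d_neq0] := eqVneq d 0.
  (* With d = 0 the quadratic is affine in the second argument; this choice gives it the value -b^2,
     so b = 0. *)
  have := key b (- (a + 1) / 2); rewrite d_eq0 !mulr0 addr0.
  have -> : b ^+ 2 * a + 2 * (b * (- (a + 1) / 2) * b) = - b ^+ 2 by field.
  by rewrite oppr_ge0.
have d_gt0 : 0 < d by rewrite lt_neqAle eq_sym d_neq0.
have := key d (- b).
have -> : d ^+ 2 * a + 2 * (d * - b * b) + (- b) ^+ 2 * d = d * (a * d - b ^+ 2) by ring.
by rewrite pmulr_rge0 // subr_ge0.
Qed.
End QuadraticForms.

Section PsdPowers.
Variables (R : realType) (n : nat).
Implicit Types (Q K L : 'M[R]_n) (x y v : 'rV[R]_n) (c : R).

Lemma psdmxE Q : psdmx Q <-> Q^T = Q /\ forall x, 0 <= qform Q x.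
Proof. by []. Qed.

Lemma qformZ a Q x : qform (a *: Q) x = a * qform Q x.
Proof. by rewrite /qform /bform -scalemxAr -scalemxAl mxE. Qed.

Lemma not_psdmxP Q : Q^T = Q -> ~ psdmx Q -> exists2 x, x != 0 & qform Q x < 0.
Proof.
move=> sQ nQ; apply: contrapT => h; apply: nQ; apply/psdmxE; split=> // x.
rewrite leNgt; apply/negP => Qx; apply: h; exists x => //.
by apply: contraTneq Qx => ->; rewrite /qform /bform !mul0mx mxE ltxx.
Qed.

Lemma expmxS K k : K ^+ k.+1 = K *m K ^+ k.
Proof. by rewrite exprS. Qed.

Lemma expmxSr K k : K ^+ k.+1 = K ^+ k *m K.
Proof. by rewrite exprSr. Qed.

Lemma expmx0 K : K ^+ 0 = 1%:M.
Proof. by []. Qed.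

Lemma trmxX K k : K^T = K -> (K ^+ k)^T = K ^+ k.
Proof.
move=> sK; elim: k => [|k IH]; first by rewrite expmx0 trmx1.
by rewrite expmxS trmx_mul IH sK -expmxSr expmxS.
Qed.

Lemma psdmxD K L : psdmx K -> psdmx L -> psdmx (K + L).
Proof.
move=> [sK K0] [sL L0]; apply/psdmxE; split; first by rewrite linearD /= sK sL.
by move=> x; rewrite /qform bformD addr_ge0 //; [exact: K0|exact: L0].
Qed.

Lemma psdmx_scalar c : 0 <= c -> psdmx (c%:M : 'M[R]_n).
Proof.
move=> c0; apply/psdmxE; split; first exact: tr_scalar_mx.
by move=> x; rewrite qform_scalar mulr_ge0 ?sqnorm_ge0.
Qed.

Lemma psdmx_gram N (A : 'M[R]_(N, n)) : psdmx (A^T *m A).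
Proof.
apply/psdmxE; split; first by rewrite trmx_mul trmxK.
move=> x; rewrite qform_gram.
by apply: sumr_ge0 => i _; rewrite sqr_ge0.
Qed.

Lemma bformMr Q K x y : K^T = K -> bform (Q *m K) x y = bform Q x (y *m K).
Proof. by move=> sK; rewrite /bform trmx_mul sK !mulmxA. Qed.

Lemma psdmxX K k : psdmx K -> psdmx (K ^+ k).
Proof.
move=> psdK; have [sK K0] := psdK; apply/psdmxE; split; first exact: trmxX.
(* Two consecutive exponents are carried along because K^(k+2) = K K^k K lowers the exponent by
   two. *)
suff: forall x, 0 <= qform (K ^+ k) x /\ 0 <= qform (K ^+ k.+1) x.
  by move=> + x => /(_ x)[].
elim: k => [|k IH] x; split.
- by rewrite expmx0 qform_scalar mul1r sqnorm_ge0.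
- exact: K0.
- by have [] := IH x.
- rewrite expmxS expmxSr.
  by rewrite /qform bformM bformMr //; have [] := IH (x *m K).
Qed.

Lemma psdmx_shift_ge K c x : psdmx (K - c%:M) -> c * sqnorm x <= qform K x.
Proof.
by case/psdmxE=> _ /(_ x); rewrite /qform bformB subr_ge0 -/(qform _ _) qform_scalar.
Qed.

Lemma qformX0 K x : qform (K ^+ 0) x = sqnorm x.
Proof. by rewrite expmx0 qform_scalar mul1r. Qed.

(** Cauchy-Schwarz for the form K^k, applied to x and x K. *)
Lemma qformX_logconvex K x k : psdmx K ->
  qform (K ^+ k.+1) x ^+ 2 <= qform (K ^+ k) x * qform (K ^+ k.+2) x.
Proof.
move=> psdK; have [sK _] := psdK.
have -> : qform (K ^+ k.+1) x = bform (K ^+ k) x (x *m K).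
  by rewrite expmxSr /qform bformMr.
have -> : qform (K ^+ k.+2) x = qform (K ^+ k) (x *m K).
  rewrite expmxS expmxSr.
  by rewrite /qform bformM bformMr.
exact/bform_cauchy_schwarz/psdmxX.
Qed.

Lemma qformX_ge0 K x k : psdmx K -> 0 <= qform (K ^+ k) x.
Proof. by move=> /(psdmxX k)[_]; apply. Qed.

Lemma qform0 Q : qform Q 0 = 0.
Proof. by rewrite /qform /bform !mul0mx mxE. Qed.

Lemma qformX_mul K c x i j : 0 < c -> psdmx K -> psdmx (K - c%:M) ->
  qform (K ^+ i) x * qform (K ^+ j) x <= sqnorm x * qform (K ^+ (i + j)) x.
Proof.
move=> c0 psdK psdKc; have [->|x0] := eqVneq x 0.
  by rewrite !qform0 mulr0 mulr_ge0 ?sqnorm_ge0.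
rewrite -(qformX0 K); apply: (@logconvex_mul _ c (fun k => qform (K ^+ k) x)) => //.
- by rewrite qformX0 sqnorm_gt0.
- by move=> k; exact: qformX_ge0.
- by rewrite qformX0 expr1; exact: psdmx_shift_ge.
- by move=> k; exact: qformX_logconvex.
Qed.

Lemma qformX_step K c x k : 0 < c -> psdmx K -> psdmx (K - c%:M) ->
  c * qform (K ^+ k) x <= qform (K ^+ k.+1) x.
Proof.
move=> c0 psdK psdKc; have [->|x0] := eqVneq x 0.
  by rewrite !qform0 mulr0.
apply: (@logconvex_step _ c (fun k => qform (K ^+ k) x)) => //.
- by rewrite qformX0 sqnorm_gt0.
- by move=> j; exact: qformX_ge0.
- by rewrite qformX0 expr1; exact: psdmx_shift_ge.
- by move=> j; exact: qformX_logconvex.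
Qed.

Lemma rank1_mxE v j k : (v^T *m v) j k = v 0 j * v 0 k.
Proof. by rewrite mxE big_ord1 mxE. Qed.

Lemma mxtrace_rank1 Q v : \tr (Q *m (v^T *m v)) = qform Q v.
Proof. by rewrite mulmxA mxtrace_mulC mulmxA /qform /bform /mxtrace big_ord1. Qed.

Lemma qform_rank1 v x : qform (v^T *m v) x = (x *m v^T) 0 0 ^+ 2.
Proof.
rewrite qform_gram big_ord1; congr (_ ^+ 2).
by rewrite -[LHS]/((v *m x^T) 0 0) -[v in LHS]trmxK -trmx_mul mxE.
Qed.

Lemma qform_mul_rank1 Q v K : Q^T = Q -> K^T = K ->
  qform (Q *m (v^T *m v) *m K) v = qform Q v * qform K v.
Proof.
move=> sQ sK; rewrite /qform {1}/bform.
have -> : v *m (Q *m (v^T *m v) *m K) *m v^T = (v *m Q *m v^T) *m (v *m K *m v^T).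
  by rewrite !mulmxA.
by rewrite mxE big_ord1.
Qed.

(** * Traces of powers under a rank-one update *)

Section RankOneUpdate.
Variables (K : 'M[R]_n) (c : R) (v : 'rV[R]_n).
Hypotheses (c_gt0 : 0 < c) (psdK : psdmx K) (psdKc : psdmx (K - c%:M)).
Let L := K + v^T *m v.
Let phi k := qform (K ^+ k) v.
(* [mixed a b] is the error made when one factor L = K + v^T v of the product
   L^(a+1) K^b is replaced by K inside a trace. *)
Let mixed a b := qform (L ^+ a *m K ^+ b) v.
Let r := 1 + sqnorm v / c.

Let psdL : psdmx L. Proof. exact: psdmxD psdK (psdmx_gram v). Qed.

Let mixed0l b : mixed 0 b = phi b.
Proof. by rewrite /mixed expmx0 mul1mx. Qed.

Let mixed0r a : mixed a 0 = qform (L ^+ a) v.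
Proof. by rewrite /mixed expmx0 mulmx1. Qed.

Let mixedS a b : mixed a.+1 b = mixed a b.+1 + mixed a 0 * phi b.
Proof.
rewrite mixed0r /phi -qform_mul_rank1; last 2 first.
- by apply: trmxX; have [] := psdL.
- by apply: trmxX; have [] := psdK.
rewrite /mixed /qform -bformD; congr bform.
rewrite expmxSr [K ^+ b.+1]expmxS.
by rewrite [in _ *m L]/L mulmxDr mulmxDl !mulmxA.
Qed.

Let r_ge1 : 1 <= r.
Proof. by rewrite lerDl divr_ge0 ?sqnorm_ge0 ?ltW. Qed.

(** In [mixedS] the product term is at most r^a phi(a) phi(b), and phi(a) phi(b) <= |v|^2 phi(a + b)
    <= (|v|^2 / c) phi(a + b + 1), the last step because K >= c. Each factor L thus costs 1 + |v|^2
    / c. *)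
Let mixed_le a b : mixed a b <= r ^+ a * phi (a + b)%N.
Proof.
elim: a b => [|a IH] b; first by rewrite mixed0l expr0 mul1r.
rewrite mixedS.
apply: (@le_trans _ _ (r ^+ a * phi (a + b.+1)%N + r ^+ a * phi a * phi b)).
  apply: lerD; first exact: IH.
  apply: ler_wpM2r; first exact: qformX_ge0.
  by rewrite -[X in phi X]addn0.
rewrite -mulrA -mulrDr exprSr -mulrA ler_wpM2l //.
  by rewrite exprn_ge0 // (le_trans ler01).
rewrite addnS addSn /r mulrDl mul1r lerD2l.
apply: (le_trans (qformX_mul v a b c_gt0 psdK psdKc)).
rewrite -mulrA ler_wpM2l ?sqnorm_ge0 // ler_pdivlMl //.
exact: qformX_step.
Qed.

Let mixed_ge a b : phi (a + b)%N <= mixed a b.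
Proof.
elim: a b => [|a IH] b; first by rewrite mixed0l.
rewrite mixedS addSnnS; apply: (le_trans (IH _)); rewrite lerDl mixed0r.
by rewrite mulr_ge0 ?qformX_ge0.
Qed.

Let traceS a b : \tr (L ^+ a.+1 *m K ^+ b) = \tr (L ^+ a *m K ^+ b.+1) + mixed a b.
Proof.
have [sL _] := psdL; have [sK _] := psdK.
(* Cyclicity alone would give v K^b L^a v^T; transposing first restores the order, since K, L and
   v^T v are symmetric. *)
have -> : mixed a b = \tr (L ^+ a *m (v^T *m v) *m K ^+ b).
  rewrite -mxtrace_tr !trmx_mul trmxK !trmxX // mulmxA mxtrace_mulC mulmxA.
  by rewrite mxtrace_rank1.
rewrite -mxtraceD; congr mxtrace.
rewrite expmxSr [K ^+ b.+1]expmxS.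
by rewrite [in _ *m L]/L mulmxDr mulmxDl !mulmxA.
Qed.

(** The factors L are exchanged for K one at a time. Every exchange has a + b = p, so all p + 1
    errors are bounded by the same r^p phi(p). *)
Lemma mxtraceX_rank1_le p :
  \tr (L ^+ p.+1) <= \tr (K ^+ p.+1) + p.+1%:R * r ^+ p * qform (K ^+ p) v.
Proof.
have key a : (a <= p.+1)%N -> \tr (L ^+ p.+1) <=
    \tr (L ^+ (p.+1 - a) *m K ^+ a) + a%:R * r ^+ p * phi p.
  elim: a => [|a IH] ap.
    by rewrite subn0 expmx0 mulmx1 mul0r mul0r addr0.
  apply: (le_trans (IH (ltnW ap))).
  rewrite subSn // traceS -addrA lerD2l -natr1 !mulrDl mul1r addrC lerD2l.
  apply: (le_trans (mixed_le _ _)); rewrite subnK //.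
  rewrite ler_wpM2r ?qformX_ge0 // ler_weXn2l //; exact: leq_subr.
by have := key p.+1 (leqnn _); rewrite subnn expmx0 mul1mx.
Qed.

Lemma mxtraceX_rank1_ge p :
  \tr (K ^+ p.+1) + p.+1%:R * qform (K ^+ p) v <= \tr (L ^+ p.+1).
Proof.
have key a : (a <= p.+1)%N ->
    \tr (L ^+ (p.+1 - a) *m K ^+ a) + a%:R * phi p <= \tr (L ^+ p.+1).
  elim: a => [|a IH] ap.
    by rewrite subn0 expmx0 mulmx1 mul0r addr0.
  apply: le_trans (IH (ltnW ap)); rewrite subSS.
  rewrite (subSn (ap : a <= p)%N) traceS -addrA lerD2l -natr1 mulrDl mul1r [leRHS]addrC lerD2l.
  by apply: le_trans (mixed_ge _ _); rewrite subnK.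
by have := key p.+1 (leqnn _); rewrite subnn expmx0 mul1mx.
Qed.

(** Serves the lower bound, where rows are subtracted: there [L] is the matrix independent of v, so
    the form at K must be bounded from below by the form at L. *)
Lemma qformX_rank1_le p : qform (L ^+ p) v <= r ^+ p * qform (K ^+ p) v.
Proof. by rewrite -mixed0r; apply: (le_trans (mixed_le _ _)); rewrite addn0. Qed.

End RankOneUpdate.

(** Coordinate by coordinate, Cauchy-Schwarz against the basis vector e_j brings out the diagonal
    entry Q_jj. *)
Lemma sqnorm_mulmx_le Q x : psdmx Q -> sqnorm (x *m Q) <= \tr Q * qform Q x.
Proof.
move=> psdQ; rewrite /mxtrace mulr_suml; apply: ler_sum => j _.
have -> : (x *m Q) 0 j = bform Q x (delta_mx 0 j).
  by rewrite /bform trmx_delta -colE [RHS]mxE.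
have <- : qform Q (delta_mx 0 j) = Q j j.
  by rewrite /qform /bform trmx_delta -rowE -colE !mxE.
by rewrite [leRHS]mulrC; exact: bform_cauchy_schwarz.
Qed.

Lemma qform_sqr_le Q x : qform Q x ^+ 2 <= sqnorm (x *m Q) * sqnorm x.
Proof.
have -> : qform Q x = bform 1%:M (x *m Q) x by rewrite /qform -bformM mulmx1.
apply: (le_trans (bform_cauchy_schwarz _ _ (psdmx_scalar ler01))).
by rewrite !qform_scalar !mul1r.
Qed.

Lemma mxtrace_psd_ge0 Q : psdmx Q -> 0 <= \tr Q.
Proof.
move=> /psdmxE[_ Q0]; apply: sumr_ge0 => j _.
have <- : qform Q (delta_mx 0 j) = Q j j.
  by rewrite /qform /bform trmx_delta -rowE -colE !mxE.
exact: Q0.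
Qed.

(** The trace dominates the top eigenvalue, shown without diagonalising: with q = [qform Q x], the
    two previous bounds give q^2 <= tr(Q) q |x|^2, and q cancels. *)
Lemma qform_le_mxtrace Q x : psdmx Q -> qform Q x <= \tr Q * sqnorm x.
Proof.
move=> psdQ; have /psdmxE[_ /(_ x)] := psdQ.
rewrite le_eqVlt => /predU1P[<-|q_gt0].
  by rewrite mulr_ge0 ?sqnorm_ge0 ?mxtrace_psd_ge0.
rewrite -(ler_pM2r q_gt0) -expr2; apply: (le_trans (qform_sqr_le _ _)).
by rewrite mulrAC ler_wpM2r ?sqnorm_ge0 ?sqnorm_mulmx_le.
Qed.

(** A single vector with large Rayleigh quotient makes the trace of the power large, which is what
    feeds Markov's inequality. By [logconvex_exp] the quotient of K^k is at least the k-th power of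
    that of K. *)
Lemma mxtraceX_rayleigh K b x k : 0 < b -> psdmx K -> x != 0 ->
  b * sqnorm x <= qform K x -> b ^+ k <= \tr (K ^+ k).
Proof.
move=> b0 psdK x0 bx; have x_gt0 : 0 < sqnorm x by rewrite sqnorm_gt0.
have := @logconvex_exp _ b (fun k => qform (K ^+ k) x) b0.
rewrite qformX0 expr1 => /(_ x_gt0 (fun k => qformX_ge0 x k psdK) bx
  (fun k => qformX_logconvex x k psdK) k) h.
rewrite -(ler_pM2r (exprn_gt0 k.+1 x_gt0)).
rewrite exprS; apply: (@le_trans _ _ (qform K x ^+ k * sqnorm x)).
  rewrite [sqnorm x * _]mulrC mulrA ler_pM2r // -exprMn lerXn2r ?nnegrE //.
    by rewrite mulr_ge0 ?ltW.
  by rewrite (le_trans _ bx) // mulr_ge0 ?ltW.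
apply: (le_trans h); rewrite mulrA ler_pM2r ?exprn_gt0 //.
exact/qform_le_mxtrace/psdmxX.
Qed.

End PsdPowers.

(** * Spectrum of real symmetric matrices *)

Section CharPolySimilar.
Variable F : fieldType.

Lemma char_poly_conj n (P B : 'M[F]_n) : P \in unitmx ->
  char_poly (invmx P *m B *m P) = char_poly B.
Proof.
move=> uP; rewrite /char_poly.
have -> : char_poly_mx (invmx P *m B *m P) =
    map_mx polyC (invmx P) *m char_poly_mx B *m map_mx polyC P.
  rewrite /char_poly_mx mulmxBr mulmxBl -!map_mxM /= mul_mx_scalar -scalemxAl.
  by rewrite -map_mxM /= mulVmx // map_mx1 scalemx1.
rewrite !det_mulmx mulrAC -det_mulmx -map_mxM /= mulVmx // map_mx1 det1 mul1r.
by [].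
Qed.

Lemma horner_mx_diagonalizable n (P B : 'M[F]_n.+1) (d : 'rV[F]_n.+1) (p : {poly F}) :
  P \in unitmx -> B = invmx P *m diag_mx d *m P ->
  (forall j, root p (d 0 j)) -> horner_mx B p = 0.
Proof.
move=> uP -> pd; rewrite -[X in _ *m X]invmxK horner_mx_uconj ?unitmx_inv //.
rewrite horner_mx_diag [map_mx _ _](_ : _ = 0) ?raddf0 ?mulmx0 ?mul0mx //.
by apply/rowP => j; rewrite !mxE; exact/rootP/pd.
Qed.

(** Gives functions of a symmetric matrix as polynomials in it, so that symmetry is inherited. A new
    node is handled by adding a multiple of the polynomial vanishing on the old ones. *)
Lemma poly_interpolation (s : seq F) (f : F -> F) : 
  exists p : {poly F}, forall a, a \in s -> p.[a] = f a.
Proof.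
elim: s => [|a s [p ps]]; first by exists 0.
have [as_|nas] := boolP (a \in s).
  by exists p => b; rewrite inE => /predU1P[->|]; exact: ps.
pose q : {poly F} := \prod_(b <- s) ('X - b%:P).
have qa : q.[a] != 0 by rewrite -rootE root_prod_XsubC.
exists (p + ((f a - p.[a]) / q.[a])%:P * q) => b; rewrite inE !hornerE.
have [->|ba /= bs] := eqVneq b a; first by rewrite divfK // addrC subrK.
have /rootP -> : root q b by rewrite root_prod_XsubC.
by rewrite mulr0 addr0 ps.
Qed.

End CharPolySimilar.

Section SymmetricSpectrum.
Variable R : realType.

(** Q is diagonalised over [R[i]] as a Hermitian matrix, whose eigenvalues are real. The second
    clause records diagonalisability: a polynomial vanishing on the eigenvalues kills Q, whatever
    the multiplicities. *)
Lemma symmetric_spectrum n (Q : 'M[R]_n.+1) : Q^T = Q ->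
  exists2 s : seq R, char_poly Q = \prod_(a <- s) ('X - a%:P) &
    forall p : {poly R}, (forall a, a \in s -> root p a) -> horner_mx Q p = 0.
Proof.
move=> sQ; pose toC := real_complex R; pose A : 'M[R[i]]_n.+1 := map_mx toC Q.
have hermA : A \is hermsymmx.
  apply: realsym_hermsym.
    apply/is_hermitianmxP; rewrite expr0 scale1r map_mx_id //.
    by rewrite /A map_trmx sQ.
  by apply/mxOverP => i j; rewrite mxE complex_real.
have /orthomx_spectralP := hermitian_normalmx hermA.
have := hermitian_spectral_diag_real hermA.
set P := spectralmx A; set d := spectral_diag A => d_real A_eq.
have uP : P \in unitmx by exact: spectral_unit.
have dE j : d 0 j = toC (complex.Re (d 0 j)).
  by have /mxOverP/(_ 0 j) := d_real; move=> /RRe_real.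
exists [seq complex.Re (d 0 j) | j : 'I_n.+1].
  apply: (map_poly_inj toC); rewrite map_char_poly -/A A_eq char_poly_conj //.
  rewrite char_poly_trig ?diag_mx_is_trig // big_map rmorph_prod /=.
  rewrite big_enum; apply: eq_bigr => j _.
  by rewrite rmorphB /= map_polyX map_polyC /= mxE eqxx mulr1n {1}dE.
move=> p ps; apply: (@map_mx_inj _ _ toC).
rewrite map_horner_mx -/A map_mx0.
apply: (horner_mx_diagonalizable uP A_eq) => j.
by rewrite dE fmorph_root; exact/ps/codom_f.
Qed.

Lemma trmx_horner n (Q : 'M[R]_n.+1) p : Q^T = Q -> (horner_mx Q p)^T = horner_mx Q p.
Proof.
move=> sQ; elim/poly_ind: p => [|p c IH]; first by rewrite rmorph0 trmx0.
rewrite rmorphD rmorphM /= horner_mx_X horner_mx_C linearD /= tr_scalar_mx.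
by rewrite trmx_mul IH sQ; congr (_ + _); exact: comm_mx_horner.
Qed.

(* A fourth root rather than a square root: its square is then a square root
   that is visibly positive semidefinite. *)
Lemma symmetric_fourth_root n (Q : 'M[R]_n.+1) : Q^T = Q ->
  (forall a, root (char_poly Q) a -> 0 <= a) ->
  exists2 E : 'M[R]_n.+1, E^T = E & E ^+ 4 = Q.
Proof.
move=> sQ Q_ge0; have [s Qs sP] := symmetric_spectrum sQ.
have [p ps] := poly_interpolation s (fun a => Num.sqrt (Num.sqrt a)).
exists (horner_mx Q p); first exact: trmx_horner.
apply/eqP; rewrite -subr_eq0 -{2}[Q]horner_mx_X -rmorphXn /= -rmorphB /=.
apply/eqP/sP => a as_; apply/rootP; rewrite !hornerE ps // (exprM _ 2 2).
rewrite !sqr_sqrtr ?subrr ?sqrtr_ge0 // Q_ge0 // Qs root_prod_XsubC //.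
Qed.

Lemma psdmx_square n (E : 'M[R]_n) : E^T = E -> psdmx (E *m E).
Proof. by move=> sE; rewrite -{1}sE; exact: psdmx_gram. Qed.

Lemma symmetric_psdmx n (Q : 'M[R]_n) : Q^T = Q ->
  (forall a, root (char_poly Q) a -> 0 <= a) -> psdmx Q.
Proof.
case: n Q => [|n] Q sQ Q_ge0.
  by split => // x; rewrite thinmx0 !mul0mx mxE.
have [E sE <-] := symmetric_fourth_root sQ Q_ge0.
by rewrite (exprM _ 2 2) expr2; apply: psdmx_square; exact: trmxX.
Qed.

Lemma char_poly_eigenvector n (Q : 'M[R]_n) a : root (char_poly Q) a ->
  exists2 x : 'rV[R]_n, x != 0 & x *m Q = a *: x.
Proof.
rewrite -eigenvalue_root_char => /eigenvalueP[x xQ x0].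
by exists x.
Qed.

Lemma psdmx_root_ge0 n (Q : 'M[R]_n) a : psdmx Q -> root (char_poly Q) a -> 0 <= a.
Proof.
move=> /psdmxE[_ Q0] /char_poly_eigenvector[x x0 xQ].
have := Q0 x; rewrite /qform /bform xQ -scalemxAl mxE -sqnormE.
by rewrite pmulr_lge0 // sqnorm_gt0.
Qed.

Lemma sqrtmxP n (M : 'M[R]_n) : psdmx M ->
  psdmx (sqrtmx M) /\ sqrtmx M *m sqrtmx M = M.
Proof.
move=> psdM; suff: [set B : 'M[R]_n | psdmx B /\ B *m B = M] (sqrtmx M) by [].
apply: xgetPex; case: n M psdM => [|n] M psdM.
  by exists 0; split; [rewrite -(flatmx0 M)|rewrite mul0mx [M]flatmx0].
have [sM _] := psdM.
have [E sE EM] := symmetric_fourth_root sM (fun a => psdmx_root_ge0 psdM).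
exists (E *m E); split; first exact: psdmx_square.
by rewrite -EM (exprM _ 2 2) !expr2.
Qed.

Lemma eigenvaluesP n (M : 'M[R]_n) : M^T = M ->
  sorted >=%R (eigenvalues M) /\
  char_poly M = \prod_(a <- eigenvalues M) ('X - a%:P).
Proof.
move=> sM; suff: [set s : seq R | sorted >=%R s /\
    char_poly M = \prod_(a <- s) ('X - a%:P)] (eigenvalues M) by [].
apply: xgetPex; case: n M sM => [|n] M sM.
  by exists [::]; split => //; rewrite big_nil /char_poly det_mx00.
have [s Ms _] := symmetric_spectrum sM.
exists (sort >=%R s); split; first by apply: sort_sorted => a b; exact: le_total.
by rewrite Ms; apply/perm_big; rewrite perm_sym perm_sort.
Qed.

Lemma size_eigenvalues n (M : 'M[R]_n) : M^T = M -> size (eigenvalues M) = n.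
Proof.
move=> /eigenvaluesP[_ /(congr1 (fun p : {poly R} => size p))].
by rewrite size_char_poly size_prod_XsubC => -[].
Qed.

End SymmetricSpectrum.

(** * Singular values through semidefinite inequalities *)

Section SingularValues.
Variable R : realType.

Lemma eigenvector_root n (Q : 'M[R]_n) (x : 'rV[R]_n) a :
  x != 0 -> x *m Q = a *: x -> root (char_poly Q) a.
Proof. by move=> x0 xQ; rewrite -eigenvalue_root_char; apply/eigenvalueP; exists x. Qed.

(** If x B^2 = r^2 x, then x B + r x is an eigenvector of B for r, unless it vanishes. In that case
    x belongs to -r, so B >= 0 forces r = 0 and x itself serves. *)
Lemma root_char_poly_sqrt n (B : 'M[R]_n) a : psdmx B ->
  root (char_poly (B *m B)) a -> 0 <= a /\ root (char_poly B) (Num.sqrt a).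
Proof.
move=> psdB aBB; have [sB _] := psdB.
have a0 : 0 <= a := psdmx_root_ge0 (psdmx_square sB) aBB.
split=> //; have [x x0 xBB] := char_poly_eigenvector aBB.
set r := Num.sqrt a; have rr : r * r = a by rewrite -expr2 sqr_sqrtr.
have [yE|y0] := eqVneq (x *m B + r *: x) 0.
  have xB : x *m B = (- r) *: x by rewrite scaleNr; apply/eqP; rewrite -addr_eq0 yE.
  have := psdmx_root_ge0 psdB (eigenvector_root x0 xB); rewrite oppr_ge0 => r0.
  have r_eq0 : r = 0 by apply: le_anti; rewrite r0 sqrtr_ge0.
  by apply: (eigenvector_root x0); rewrite xB r_eq0 oppr0.
apply: (eigenvector_root y0).
by rewrite mulmxDl -mulmxA xBB -scalemxAl scalerDr scalerA rr addrC.
Qed.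

Variables (N n : nat) (A : 'M[R]_(N, n)).
Hypothesis n_gt0 : (0 < n)%N.
Let B := sqrtmx (A^T *m A).

Let psdB : psdmx B.
Proof. by have [] := sqrtmxP (psdmx_gram A). Qed.

Let BB : B *m B = A^T *m A.
Proof. by have [] := sqrtmxP (psdmx_gram A). Qed.

Let sB : B^T = B. Proof. by have [] := psdB. Qed.

Let size_sv : size (singular_values A) = n.
Proof. exact: size_eigenvalues. Qed.

Let root_sv a : root (char_poly B) a = (a \in singular_values A).
Proof. by have [_ ->] := eigenvaluesP sB; rewrite root_prod_XsubC. Qed.

Let root_smin : root (char_poly B) (s_min A).
Proof. by rewrite root_sv mem_nth // size_sv prednK. Qed.

Let root_smax : root (char_poly B) (s_max A).
Proof. by rewrite root_sv mem_nth // size_sv. Qed.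

Let sorted_sv i j : (i <= j < n)%N ->
  (singular_values A)`_j <= (singular_values A)`_i.
Proof.
move=> /andP[ij jn].
have [sorted_s _] := eigenvaluesP sB.
apply: (sorted_leq_nth _ _ 0 sorted_s) => //.
- by move=> a b c /[swap]; exact: le_trans.
- by move=> a; exact: lexx.
- by rewrite inE size_sv (leq_ltn_trans ij).
- by rewrite inE size_sv.
Qed.

Let root_bounds a : root (char_poly B) a -> s_min A <= a <= s_max A.
Proof.
rewrite root_sv; case/(nthP 0) => i; rewrite size_sv => i_n <-.
by rewrite /s_min /s_max !sorted_sv ?ltn_predL ?i_n ?n_gt0 ?andbT //= -ltnS prednK.
Qed.

Lemma s_min_ge0 : 0 <= s_min A.
Proof. exact: psdmx_root_ge0 root_smin. Qed.

Lemma s_min_le_s_max : s_min A <= s_max A.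
Proof. by have /andP[] := root_bounds root_smin. Qed.

(** Forward, an eigenvalue a of b^2 - A^T A makes b^2 - a an eigenvalue of B^2, whose root is a
    singular value, hence at most b. Backward, the form is tested on an eigenvector of B for
    [s_max A]. *)
Lemma s_max_leP b : 0 <= b -> s_max A <= b <-> psdmx ((b ^+ 2)%:M - A^T *m A).
Proof.
move=> b0; split => [sb|psd].
  apply: symmetric_psdmx; first by rewrite linearB /= tr_scalar_mx trmx_mul trmxK.
  move=> a /char_poly_eigenvector[x x0 xE].
  have : x *m (B *m B) = (b ^+ 2 - a) *: x.
    by rewrite BB scalerBl -xE mulmxBr mul_mx_scalar opprB addrC subrK.
  move=> /(eigenvector_root x0)/(root_char_poly_sqrt psdB)[c0 /root_bounds/andP[_ h]].
  have : Num.sqrt (b ^+ 2 - a) ^+ 2 <= b ^+ 2.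
    by rewrite lerXn2r ?nnegrE ?sqrtr_ge0 // (le_trans h).
  by rewrite sqr_sqrtr // gerBl.
have [x x0 xB] := char_poly_eigenvector root_smax.
have xA : x *m (A^T *m A) = (s_max A ^+ 2) *: x.
  by rewrite -BB mulmxA xB -scalemxAl xB scalerA expr2.
have [_ /(_ x)] := psd.
rewrite mulmxBr mulmxBl xA mul_mx_scalar -!scalemxAl !mxE -/(sqnorm x).
have -> : \sum_j x 0 j * x^T j 0 = sqnorm x.
  by apply: eq_bigr => j _; rewrite mxE expr2.
rewrite -mulrBl pmulr_lge0 ?sqnorm_gt0 // subr_ge0 => h.
by move: h; rewrite ler_pXn2r ?nnegrE // (le_trans s_min_ge0 s_min_le_s_max).
Qed.

Lemma s_min_geP a : 0 <= a -> a <= s_min A <-> psdmx (A^T *m A - (a ^+ 2)%:M).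
Proof.
move=> a0; split => [sa|psd].
  apply: symmetric_psdmx; first by rewrite linearB /= tr_scalar_mx trmx_mul trmxK.
  move=> c /char_poly_eigenvector[x x0 xE].
  have : x *m (B *m B) = (c + a ^+ 2) *: x.
    by rewrite BB scalerDl -xE mulmxBr mul_mx_scalar subrK.
  move=> /(eigenvector_root x0)/(root_char_poly_sqrt psdB)[c0 /root_bounds/andP[h _]].
  have : a ^+ 2 <= Num.sqrt (c + a ^+ 2) ^+ 2.
    by rewrite lerXn2r ?nnegrE ?sqrtr_ge0 // (le_trans sa).
  by rewrite sqr_sqrtr // lerDr.
have [x x0 xB] := char_poly_eigenvector root_smin.
have xA : x *m (A^T *m A) = (s_min A ^+ 2) *: x.
  by rewrite -BB mulmxA xB -scalemxAl xB scalerA expr2.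
have [_ /(_ x)] := psd.
rewrite mulmxBr mulmxBl xA mul_mx_scalar -!scalemxAl !mxE.
have -> : \sum_j x 0 j * x^T j 0 = sqnorm x.
  by apply: eq_bigr => j _; rewrite mxE expr2.
rewrite -mulrBl pmulr_lge0 ?sqnorm_gt0 // subr_ge0 => h.
by move: h; rewrite ler_pXn2r ?nnegrE // s_min_ge0.
Qed.

End SingularValues.

(** * Measurability of positive semidefiniteness *)

Section RationalVectors.
Variables (R : realType) (n : nat).

Definition ratrV (q : 'rV[rat]_n) : 'rV[R]_n := map_mx ratr q.

Lemma ratrV_dense (O : set 'rV[R]_n) : open O -> O !=set0 -> exists q, O (ratrV q).
Proof.
rewrite openE => oO [x /oO/nbhs_ballP[e e0 xeO]].
have /choice[q qP] (j : 'I_n) : exists q : rat, ball (x 0 j) e (ratr q).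
  have [y [yb [q _ qy]]] : ball (x 0 j) e `&` (@ratr R @` setT) !=set0.
    by apply: dense_rat; [exists (x 0 j); exact: ballxx|exact: ball_open].
  by exists q; rewrite qy.
exists (\row_j q j); apply: xeO; split=> // i j.
by rewrite !mxE ord1.
Qed.

Lemma continuous_sum (U : topologicalType) (I : Type) (r : seq I) (F : I -> U -> R) :
  (forall i, continuous (F i)) -> continuous (fun x => \sum_(i <- r) F i x).
Proof. by move=> cF; apply: continuous_big => // ; exact: add_continuous. Qed.

Lemma qform_continuous (Q : 'M[R]_n) : continuous (qform Q).
Proof.
have -> : qform Q = fun x => \sum_k (\sum_j x 0 j * Q j k) * x 0 k.
  apply/funext => x; rewrite /qform /bform mxE; apply: eq_bigr => k _.
  by rewrite !mxE.
apply: continuous_sum => k x.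
have cS : continuous (fun x : 'rV[R]_n => \sum_j x 0 j * Q j k).
  apply: continuous_sum => j y.
  by apply: continuousM; [exact: coord_continuous|exact: cst_continuous].
by apply: continuousM; [exact: cS|exact: coord_continuous].
Qed.

(** By continuity a dense set of test vectors suffices; its countability makes the event a countable
    intersection. *)
Lemma psdmx_ratrV (Q : 'M[R]_n) : Q^T = Q ->
  psdmx Q <-> forall q, 0 <= qform Q (ratrV q).
Proof.
move=> sQ; split=> [/psdmxE[_ Q0] q //|Q0]; apply/psdmxE; split=> // x.
rewrite leNgt; apply/negP => x0.
have [] := @ratrV_dense (qform Q @^-1` `]-oo, 0[%classic).
- by have /continuousP := @qform_continuous Q; apply; exact: interval_open.
- by exists x; rewrite /= in_itv.
- by move=> q; rewrite /= in_itv /= ltNge Q0.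
Qed.

End RationalVectors.

Section PsdMeasurable.
Context d (T : measurableType d) (R : realType).

Lemma measurable_qform n (Q : T -> 'M[R]_n) x :
  (forall i j, measurable_fun setT (fun w => Q w i j)) ->
  measurable_fun setT (fun w => qform (Q w) x).
Proof.
move=> mQ.
have -> : (fun w => qform (Q w) x) = fun w => \sum_k (\sum_j x 0 j * Q w j k) * x 0 k.
  apply/funext => w; rewrite /qform /bform mxE; apply: eq_bigr => k _.
  by rewrite !mxE.
apply: measurable_sum => k; apply: measurable_funM => //.
by apply: measurable_sum => j; apply: measurable_funM.
Qed.

(* The value of a probability on a non-measurable set is junk, so the event on
   the singular values has to be proved measurable. *)
Lemma measurable_psdmx n (Q : T -> 'M[R]_n) :
  (forall i j, measurable_fun setT (fun w => Q w i j)) ->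
  (forall w, (Q w)^T = Q w) -> measurable [set w | psdmx (Q w)].
Proof.
move=> mQ sQ.
have -> : [set w | psdmx (Q w)] = \bigcap_(k : nat) [set w |
    if unpickle k is Some q then 0 <= qform (Q w) (ratrV R q) else true].
  apply/seteqP; split=> w /=.
    by move=> /psdmxE[_ Q0] k _ /=; case: unpickle.
  move=> Q0; apply/(psdmx_ratrV (sQ w)) => q.
  by have := Q0 (pickle q) I; rewrite /= pickleK.
apply: bigcapT_measurable => k; case: unpickle => [q|]; last first.
  by rewrite [X in measurable X](_ : _ = setT) //; apply/seteqP; split.
rewrite [X in measurable X](_ : _ = (fun w => qform (Q w) (ratrV R q)) @^-1` `[0, +oo[); last first.
  by apply/seteqP; split=> w /=; rewrite in_itv /= andbT.
rewrite -[X in measurable X]setTI; by apply: measurable_qform.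
Qed.

Lemma measurable_coord n j :
  measurable_fun [set: borel_rV R n] (fun x : borel_rV R n => (x : 'rV[R]_n) 0 j).
Proof.
apply: (measurability _ (RGenOpens.measurableE R)) => _ [_ [a [b ->]] <-].
rewrite setTI; apply: sub_sigma_algebra.
have /continuousP : continuous (fun x : 'rV[R]_n => x 0 j) by exact: coord_continuous.
by apply; exact: interval_open.
Qed.

End PsdMeasurable.

(** * Independence and bounded measurable functions *)

Section BoundedMeasurable.
Context d (T : measurableType d) (R : realType).
Implicit Types f g : T -> R.

(** Boundedness everywhere, not merely almost surely, gives a class closed under sums and products
    in which every function is integrable. *)
Definition bounded_measurable f :=
  measurable_fun setT f /\ exists M, forall x, `|f x| <= M.

Lemma bounded_measurable_cst a : bounded_measurable (fun=> a).
Proof. by split; [exact: measurable_cst|exists `|a|]. Qed.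

Lemma bounded_measurableD f g : bounded_measurable f -> bounded_measurable g ->
  bounded_measurable (fun x => f x + g x).
Proof.
move=> [mf [M fM]] [mg [L gL]]; split; first exact: measurable_funD.
by exists (M + L) => x; rewrite (le_trans (ler_normD _ _)) // lerD.
Qed.

Lemma bounded_measurableM f g : bounded_measurable f -> bounded_measurable g ->
  bounded_measurable (fun x => f x * g x).
Proof.
move=> [mf [M fM]] [mg [L gL]]; split; first exact: measurable_funM.
by exists (M * L) => x; rewrite normrM ler_pM.
Qed.

Lemma bounded_measurableB f g : bounded_measurable f -> bounded_measurable g ->
  bounded_measurable (fun x => f x - g x).
Proof.
move=> [mf [M fM]] [mg [L gL]]; split; first exact: measurable_funB.
by exists (M + L) => x; rewrite (le_trans (ler_normB _ _)) // lerD.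
Qed.

Lemma bounded_measurable_superlevel f a : bounded_measurable f ->
  measurable [set x | a <= f x].
Proof.
move=> [mf _]; rewrite [X in measurable X](_ : _ = f @^-1` `[a, +oo[).
  by rewrite -[X in measurable X]setTI; apply: mf.
by apply/seteqP; split=> x /=; rewrite in_itv /= andbT.
Qed.

Lemma bounded_measurable_prod (I : Type) (s : seq I) (A : pred I) (F : I -> T -> R) :
  (forall i, A i -> bounded_measurable (F i)) ->
  bounded_measurable (fun x => \prod_(i <- s | A i) F i x).
Proof.
move=> bF; elim: s => [|i s IH].
  by under eq_fun do rewrite big_nil; exact: bounded_measurable_cst.
have [Ai|/negbTE nAi] := boolP (A i); last first.
  by under eq_fun do rewrite big_cons nAi.
under eq_fun do rewrite big_cons Ai.
by apply: bounded_measurableM => //; exact: bF.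
Qed.

Lemma bounded_measurable_sum (I : Type) (s : seq I) (F : I -> T -> R) :
  (forall i, bounded_measurable (F i)) ->
  bounded_measurable (fun x => \sum_(i <- s) F i x).
Proof.
move=> bF; elim: s => [|i s IH].
  by under eq_fun do rewrite big_nil; exact: bounded_measurable_cst.
by under eq_fun do rewrite big_cons; exact: bounded_measurableD.
Qed.

Lemma bounded_measurable_indic (B : set T) : measurable B -> bounded_measurable (\1_B).
Proof.
move=> mB; split; first exact: measurable_indic.
by exists 1 => x; rewrite indicE ger0_norm // lern1; case: (_ \in _).
Qed.

Variable P : probability T R.

Lemma bounded_measurable_integrable f :
  bounded_measurable f -> P.-integrable setT (EFin \o f).
Proof.
move=> [mf [M fM]]; apply: measurable_bounded_integrable => //.
  by rewrite (le_lt_trans (probability_le1 _ _)) ?ltry.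
exists M; split; first exact: num_real.
by move=> L ML x _; apply: (le_trans (fM x)); exact: ltW.
Qed.

Lemma Rintegral_indic (B : set T) : measurable B -> (\int[P]_w \1_B w)%R = fine (P B).
Proof. by move=> mB; rewrite /Rintegral integral_indic // setIT. Qed.

Lemma Rintegral_cst1 a : (\int[P]_w (cst a w) = a)%R.
Proof.
by rewrite Rintegral_cst // [X in fine X](_ : _ = 1%E) ?mulr1 //; exact: probability_setT.
Qed.

Lemma normr_Rintegral_le f M : bounded_measurable f -> (forall x, `|f x| <= M) ->
  `|(\int[P]_w f w)%R| <= M.
Proof.
move=> bf fM; have intf := bounded_measurable_integrable bf.
apply: (le_trans (le_normr_Rintegral _ intf)) => //.
rewrite -[leRHS]Rintegral_cst1.
apply: le_Rintegral => //; first exact: integrable_norm.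
exact: (bounded_measurable_integrable (bounded_measurable_cst M)).
Qed.

Lemma bounded_RintegralD f g : bounded_measurable f -> bounded_measurable g ->
  (\int[P]_w (f w + g w) = \int[P]_w f w + \int[P]_w g w)%R.
Proof.
by move=> /bounded_measurable_integrable bf /bounded_measurable_integrable bg; rewrite RintegralD.
Qed.

Lemma bounded_RintegralB f g : bounded_measurable f -> bounded_measurable g ->
  (\int[P]_w (f w - g w) = \int[P]_w f w - \int[P]_w g w)%R.
Proof.
by move=> /bounded_measurable_integrable bf /bounded_measurable_integrable bg; rewrite RintegralB.
Qed.

Lemma bounded_RintegralZl f a : bounded_measurable f ->
  (\int[P]_w (a * f w) = a * \int[P]_w f w)%R.
Proof. by move=> /bounded_measurable_integrable bf; rewrite RintegralZl. Qed.

Lemma bounded_Rintegral_sum (I : Type) (s : seq I) (F : I -> T -> R) :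
  (forall i, bounded_measurable (F i)) ->
  (\int[P]_w (\sum_(i <- s) F i w) = \sum_(i <- s) \int[P]_w F i w)%R.
Proof.
move=> bF; elim: s => [|i s IH].
  rewrite big_nil; under eq_Rintegral do rewrite big_nil.
  by rewrite Rintegral_cst // mul0r.
rewrite big_cons -IH; under eq_Rintegral do rewrite big_cons.
by rewrite bounded_RintegralD //; exact: bounded_measurable_sum.
Qed.

Lemma bounded_le_Rintegral f g : bounded_measurable f -> bounded_measurable g ->
  (forall x, f x <= g x) -> (\int[P]_w f w <= \int[P]_w g w)%R.
Proof.
move=> /bounded_measurable_integrable bf /bounded_measurable_integrable bg fg.
exact: le_Rintegral.
Qed.

Lemma markov_bounded f a : 0 < a -> bounded_measurable f -> (forall x, 0 <= f x) ->
  fine (P [set x | a <= f x]) <= (\int[P]_w f w)%R / a.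
Proof.
move=> a0 bf f0; have mA := bounded_measurable_superlevel a bf.
rewrite ler_pdivlMr // mulrC -(Rintegral_indic mA).
have b1 := bounded_measurable_indic mA.
rewrite -(bounded_RintegralZl a b1); apply: bounded_le_Rintegral => //.
  by apply: bounded_measurableM => //; exact: bounded_measurable_cst.
move=> x; rewrite indicE; case: (boolP (_ \in _)) => [|_]; last by rewrite mulr0.
by rewrite inE /= mulr1.
Qed.

End BoundedMeasurable.

Lemma bounded_measurable_comp d d' (T : measurableType d) (U : measurableType d')
    (R : realType) (X : T -> U) (f : U -> R) :
  measurable_fun setT X -> bounded_measurable f -> bounded_measurable (f \o X).
Proof.
by move=> mX [mf [M fM]]; split; [exact: measurableT_comp|exists M => x; exact: fM].
Qed.

Section Staircase.
Variable R : realType.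

(* The integer part of y when 0 <= y <= K, written as a sum of indicators. *)
Definition stair K (y : R) : R := \sum_(i < K) (i.+1%:R <= y)%R%:R.

Lemma stairP K (y : R) : 0 <= y <= K%:R -> stair K y <= y <= stair K y + 1.
Proof.
elim: K => [|K IH] /andP[y0 yK]; first by rewrite /stair big_ord0 y0 add0r (le_trans yK).
rewrite /stair big_ord_recr /= -/(stair K y).
have [Ky|yK'] := leP K%:R y; last first.
  have -> : (K.+1%:R <= y) = false.
    by apply/negbTE; rewrite -ltNge (lt_le_trans yK') // ler_nat.
  by rewrite addr0; apply: IH; rewrite y0 ltW.
have -> : stair K y = K%:R.
  rewrite /stair (eq_bigr (fun=> 1)) ?sumr_const ?card_ord // => i _.
  by rewrite (le_trans _ Ky) // ler_nat.
case: (leP K.+1%:R y) => h; first by rewrite natr1 h -[leLHS]addr0 lerD.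
by rewrite addr0 Ky natr1 ltW.
Qed.

End Staircase.

Section Factorization.
Context d (T : measurableType d) (R : realType) (P : probability T R).
Context d' (U : measurableType d').
Variables (X : T -> U) (mX : measurable_fun setT X) (G : T -> R) (c : R).
Hypothesis bG : bounded_measurable G.

Let BM (f : U -> R) : bounded_measurable f -> bounded_measurable (f \o X).
Proof. exact: bounded_measurable_comp. Qed.

Let factor f := bounded_measurable f /\
  (\int[P]_w (f (X w) * G w) = (\int[P]_w f (X w)) * c)%R.

Let factorD f g : factor f -> factor g -> factor (fun x => f x + g x).
Proof.
move=> [bf ef] [bg eg]; split; first exact: bounded_measurableD.
under eq_Rintegral do rewrite mulrDl.
have bfX := BM bf; have bgX := BM bg.
rewrite (bounded_RintegralD _ bfX bgX) mulrDl -ef -eg.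
by rewrite bounded_RintegralD //; exact: bounded_measurableM.
Qed.

Let factorZ a f : factor f -> factor (fun x => a * f x).
Proof.
move=> [bf ef]; split.
  by apply: bounded_measurableM => //; exact: bounded_measurable_cst.
under eq_Rintegral do rewrite -mulrA.
have bfX := BM bf; rewrite (bounded_RintegralZl _ _ bfX) -mulrA -ef.
by rewrite bounded_RintegralZl //; exact: bounded_measurableM.
Qed.

(** Both sides are linear in f and continuous for uniform convergence, and f is uniformly within h
    of a combination of indicators of its superlevel sets. A nonzero gap D is refuted by one small
    enough h. *)
Lemma Rintegral_factor (f : U -> R) :
  (forall B, measurable B ->
    (\int[P]_w (\1_B (X w) * G w) = (\int[P]_w \1_B (X w)) * c)%R) ->
  bounded_measurable f ->
  (\int[P]_w (f (X w) * G w) = (\int[P]_w f (X w)) * c)%R.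
Proof.
move=> indG bf; have [mf [M fM]] := bf; have [_ [L GL]] := bG.
have factor_indic B : measurable B -> factor (\1_B).
  by move=> mB; split; [exact: bounded_measurable_indic|exact: indG].
apply/eqP; rewrite -subr_eq0 -normr_eq0 eq_le normr_ge0 andbT leNgt.
apply/negP; set D := `|_| => D0.
pose C := `|L| + `|c| + 1.
have C0 : 0 < C by rewrite ltr_wpDl ?addr_ge0.
(* The approximation error is at most h (|L| + |c|), which is less than 2 C h = D. *)
pose h := D / (2 * C).
have h0 : 0 < h by rewrite divr_gt0 ?mulr_gt0.
have factor_stair k : factor (fun x => stair k ((f x + M) / h)).
  rewrite /stair; elim: k => [|k IH].
    have -> : (fun x => \sum_(i < 0) (i.+1%:R <= (f x + M) / h)%R%:R) =
        (fun x => 0 * \1_setT x) :> (U -> R).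
      by apply/funext => x; rewrite big_ord0 mul0r.
    exact/factorZ/factor_indic.
  under eq_fun do rewrite big_ord_recr /=.
  apply: factorD IH _.
  have -> : (fun x : U => (k.+1%:R <= (f x + M) / h)%R%:R : R) =
      (\1_[set x | k.+1%:R * h - M <= f x] : U -> R).
    apply/funext => x; rewrite indicE; congr (_%:R); congr nat_of_bool.
    by rewrite ler_pdivlMr // -lerBlDr; apply/idP/idP; rewrite inE.
  exact/factor_indic/bounded_measurable_superlevel.
(* Enough levels: f + M lies between 0 and 2 M. *)
pose K := (Num.truncn ((M + M) / h)).+1.
pose g x := - M + h * stair K ((f x + M) / h).
have factor_g : factor g.
  apply: (@factorD (fun=> - M)); last exact/factorZ/factor_stair.
  have -> : (fun=> - M) = (fun x : U => - M * \1_setT x).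
    by apply/funext => x; rewrite indicE in_setT mulr1.
  exact/factorZ/factor_indic.
have fg x : `|f x - g x| <= h.
  have /andP[fM1 fM2] : - M <= f x <= M by rewrite -ler_norml.
  have /stairP/andP[s1 s2] : 0 <= (f x + M) / h <= K%:R.
    rewrite divr_ge0 ?(ltW h0) //=; last by rewrite -lerBlDr sub0r.
    apply: (@le_trans _ _ ((M + M) / h)).
      by rewrite ler_pM2r ?invr_gt0 // lerD2r.
    exact/ltW/truncnS_gt.
  rewrite -(ler_pM2l h0) in s1; rewrite -(ler_pM2l h0) in s2.
  have hE : h * ((f x + M) / h) = f x + M by rewrite mulrC divfK // gt_eqF.
  rewrite hE in s1; rewrite hE mulrDr mulr1 in s2.
  by rewrite /g ler_norml; apply/andP; split; lra.
have [bg eg] := factor_g.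
have bfg : bounded_measurable (fun x => f x - g x).
  exact: bounded_measurableB.
have DE : D = `|(\int[P]_w ((f (X w) - g (X w)) * G w) - (\int[P]_w (f (X w) - g (X w))) * c)%R|.
  rewrite /D; congr (`|_|).
  under [in RHS]eq_Rintegral do rewrite mulrBl.
  have bfX := BM bf; have bgX := BM bg.
  rewrite (bounded_RintegralB _ bfX bgX).
  rewrite (bounded_RintegralB _ (bounded_measurableM bfX bG) (bounded_measurableM bgX bG)).
  by rewrite eg; ring.
have : D <= h * (`|L| + `|c|).
  rewrite DE (le_trans (ler_normB _ _)) // mulrDr lerD //.
    apply: normr_Rintegral_le; first exact: bounded_measurableM (BM bfg) bG.
    move=> w; rewrite normrM ler_pM //.
    exact: le_trans (GL w) (ler_norm L).
  rewrite normrM ler_wpM2r //; by apply: (normr_Rintegral_le _ (BM bfg)) => w; exact: fg.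
apply/negP; rewrite -ltNge.
have -> : D = h * (2 * C) by rewrite divfK // gt_eqF ?mulr_gt0.
by rewrite ltr_pM2l // /C; have := normr_ge0 L; have := normr_ge0 c; lra.
Qed.

End Factorization.

(** * Independence for products and sums of bounded functions *)

Section IndependentAlgebra.
Context d (T : measurableType d) (R : realType) (P : probability T R).
Context d' (U : measurableType d') (I : finType) (X : I -> T -> U).
Hypotheses (mX : forall i, measurable_fun setT (X i)) (indX : mutually_independent P X).

Lemma bounded_measurable_rv i (f : U -> R) :
  bounded_measurable f -> bounded_measurable (fun w => f (X i w)).
Proof. exact: bounded_measurable_comp. Qed.

Let Rintegral_prod_indic (J : {set I}) (B : I -> set U) :
  (forall i, i \in J -> measurable (B i)) ->
  (\int[P]_w \prod_(i in J) \1_(B i) (X i w) =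
   \prod_(i in J) \int[P]_w \1_(B i) (X i w))%R.
Proof.
move=> mB; pose A i := X i @^-1` B i.
have mA i : i \in J -> measurable (A i).
  by move=> iJ; rewrite /A -[X in measurable X]setTI; apply: mX => //; exact: mB.
have AE i w : \1_(B i) (X i w) = \1_(A i) w :> R.
  rewrite !indicE; suff -> : (X i w \in B i) = (w \in A i) by [].
  by apply/idP/idP; rewrite !inE.
have -> : (fun w => \prod_(i in J) \1_(B i) (X i w)) =
    \1_(\bigcap_(i in [set` J]) A i) :> (T -> R).
  apply/funext => w; rewrite indicE.
  have [wA|wA] := boolP (w \in _).
    rewrite big1 // => i iJ; rewrite AE indicE mem_set //.
    by move: wA; rewrite inE => /(_ i iJ).
  have [i iJ wAi] : exists2 i, i \in J & ~ A i w.
    apply: contrapT => h; move: wA => /negP; apply; rewrite inE => i /= iJ.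
    by apply: contrapT => wAi; apply: h; exists i.
  by rewrite (bigD1 i) //= AE indicE memNset // mul0r.
rewrite Rintegral_indic; last first.
  by apply: fin_bigcap_measurable => // i; exact: mA.
rewrite indX //.
have -> : (\prod_(i in J) P (A i) = (\prod_(i in J) fine (P (A i)))%:E)%E.
  elim/big_ind2 : _ => // [x a y b -> ->//|i iJ].
  by rewrite fineK // fin_num_measure //; exact: mA.
apply: eq_bigr => i iJ; rewrite -(Rintegral_indic P (mA i iJ)).
by apply: eq_Rintegral => w _; rewrite AE.
Qed.

Lemma Rintegral_prod_independent (J : {set I}) (f : I -> U -> R) :
  (forall i, bounded_measurable (f i)) ->
  (\int[P]_w \prod_(i in J) f i (X i w) = \prod_(i in J) \int[P]_w f i (X i w))%R.
Proof.
(* Indicators are replaced by bounded functions one index at a time; [s] lists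
   the indices already replaced. *)
suff key (s : seq I) (g : I -> U -> R) : (forall i, bounded_measurable (g i)) ->
    (forall i, i \in J -> i \notin s -> exists2 B, measurable B & g i = \1_B) ->
    (\int[P]_w \prod_(i in J) g i (X i w) = \prod_(i in J) \int[P]_w g i (X i w))%R.
  by move=> bf; apply: (key (enum I)) => // i _; rewrite mem_enum.
elim: s g => [|a s IH] g bg gs.
  have /choice[B BP] i : exists B, i \in J -> measurable B /\ g i = \1_B.
    have [iJ|niJ] := boolP (i \in J); last by exists set0.
    by have [//|B mB gB] := gs i iJ; exists B.
  have gE i w : i \in J -> g i w = \1_(B i) w by move=> /BP[_ ->].
  under eq_Rintegral do under eq_bigr do rewrite gE //.
  rewrite Rintegral_prod_indic; last by move=> i /BP[].
  by apply: eq_bigr => i iJ; apply: eq_Rintegral => w _; rewrite gE.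
have [aJ|naJ] := boolP (a \in J); last first.
  apply: IH => // i iJ nis; apply: gs => //; rewrite inE negb_or nis andbT.
  by apply: contraNneq naJ => <-.
rewrite (bigD1 a) //=; under eq_Rintegral do rewrite (bigD1 a) //=.
(* The product over the other indices plays the role of G, so it is enough to treat indicators at a;
   [g'] then has one index fewer to replace. *)
apply: (Rintegral_factor (mX a)) => //.
  by apply: bounded_measurable_prod => i _; exact: bounded_measurable_rv.
move=> B mB; pose g' i := if i == a then \1_B else g i.
have g'a : g' a = \1_B by rewrite /g' eqxx.
have g'E i : i != a -> g' i = g i by rewrite /g' => /negbTE ->.
transitivity (\int[P]_w \prod_(i in J) g' i (X i w))%R.
  apply: eq_Rintegral => w _; rewrite [RHS](bigD1 a) //= g'a; congr (_ * _).
  by apply: eq_bigr => i /andP[_ ia]; rewrite g'E.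
transitivity (\prod_(i in J) \int[P]_w g' i (X i w))%R; last first.
  rewrite (bigD1 a) //= g'a; congr (_ * _).
  by apply: eq_bigr => i /andP[_ ia]; rewrite g'E.
apply: IH.
- by move=> i; rewrite /g'; case: eqP => _; [exact: bounded_measurable_indic|exact: bg].
- move=> i iJ nis; rewrite /g'; have [_|ia] := eqVneq i a; first by exists B.
  by apply: gs => //; rewrite inE negb_or ia.
Qed.

(* This span is an algebra, and it contains the entries of the powers of the
   matrix K of the header comment; that is all the independence needed. *)
Inductive coord_algebra (S : {set I}) : (T -> R) -> Prop :=
| coord_algebra_prod f : (forall i, bounded_measurable (f i)) ->
    coord_algebra S (fun w => \prod_(i in S) f i (X i w))
| coord_algebraD Y Z : coord_algebra S Y -> coord_algebra S Z ->
    coord_algebra S (fun w => Y w + Z w)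
| coord_algebraZ a Y : coord_algebra S Y -> coord_algebra S (fun w => a * Y w).

Variable S : {set I}.

Lemma coord_algebra_bounded Y : coord_algebra S Y -> bounded_measurable Y.
Proof.
elim=> [f bf|{}Y Z _ bY _ bZ|a {}Y _ bY].
- by apply: bounded_measurable_prod => i _; exact: bounded_measurable_rv.
- exact: bounded_measurableD.
- by apply: bounded_measurableM => //; exact: bounded_measurable_cst.
Qed.

Lemma coord_algebra_rv i f : i \in S -> bounded_measurable f ->
  coord_algebra S (fun w => f (X i w)).
Proof.
move=> iS bf; pose g j := if j == i then f else fun=> 1.
have -> : (fun w => f (X i w)) = fun w => \prod_(j in S) g j (X j w).
  apply/funext => w; rewrite (bigD1 i) //= /g eqxx big1 ?mulr1 // => j /andP[_].
  by move=> /negbTE ->.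
apply: coord_algebra_prod => j; rewrite /g; case: eqP => // _.
exact: bounded_measurable_cst.
Qed.

Lemma coord_algebra_cst a : coord_algebra S (fun=> a).
Proof.
have -> : (fun=> a) = fun w => a * \prod_(i in S) (fun=> 1) (X i w).
  by apply/funext => w; rewrite big1 // mulr1.
apply: coord_algebraZ; apply: (@coord_algebra_prod S (fun _ _ => 1)) => i.
exact: bounded_measurable_cst.
Qed.

Lemma coord_algebraM Y Z : coord_algebra S Y -> coord_algebra S Z ->
  coord_algebra S (fun w => Y w * Z w).
Proof.
move=> aY aZ; elim: aY => [f bf|{}Y Y' _ IH _ IH'|a {}Y _ IH].
- elim: aZ => [g bg|{}Z Z' _ IH _ IH'|a {}Z _ IH].
  + under eq_fun do rewrite -big_split /=.
    apply: (@coord_algebra_prod S (fun i x => f i x * g i x)) => i.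
    exact: bounded_measurableM.
  + by under eq_fun do rewrite mulrDr; exact: coord_algebraD IH IH'.
  + by under eq_fun do rewrite mulrCA; exact: coord_algebraZ IH.
- by under eq_fun do rewrite mulrDl; exact: coord_algebraD IH IH'.
- by under eq_fun do rewrite -mulrA; exact: coord_algebraZ IH.
Qed.

Lemma coord_algebra_sum (K : Type) (s : seq K) (F : K -> T -> R) :
  (forall k, coord_algebra S (F k)) -> coord_algebra S (fun w => \sum_(k <- s) F k w).
Proof.
move=> aF; elim: s => [|k s IH].
  by under eq_fun do rewrite big_nil; exact: (coord_algebra_cst 0).
by under eq_fun do rewrite big_cons; exact: coord_algebraD (aF k) IH.
Qed.

(** On a generating product, f at i is simply one more factor, over the set [i |: S]; the rest is
    linearity. *)
Lemma coord_algebra_independent i f Y : i \notin S -> bounded_measurable f ->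
  coord_algebra S Y ->
  (\int[P]_w (f (X i w) * Y w) = (\int[P]_w f (X i w)) * \int[P]_w Y w)%R.
Proof.
move=> iS bf; have bfX := bounded_measurable_rv i bf.
elim=> [g bg|{}Y Z aY IHY aZ IHZ|a {}Y aY IHY].
- pose h j := if j == i then f else g j.
  have hE j : j \in S -> h j = g j.
    by move=> jS; rewrite /h; case: eqP => // ji; rewrite -ji jS in iS.
  have bh j : bounded_measurable (h j) by rewrite /h; case: ifP.
  have := Rintegral_prod_independent (i |: S) bh.
  rewrite big_setU1 //=; under eq_Rintegral do rewrite big_setU1 //=.
  rewrite {1 3}/h eqxx => hP.
  transitivity (\int[P]_w (f (X i w) * \prod_(j in S) h j (X j w)))%R.
    by apply: eq_Rintegral => w _; congr (_ * _); apply: eq_bigr => j jS; rewrite hE.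
  rewrite hP; congr (_ * _).
  rewrite (Rintegral_prod_independent S bg).
  by apply: eq_bigr => j jS; rewrite hE.
- have [bY bZ] := (coord_algebra_bounded aY, coord_algebra_bounded aZ).
  under eq_Rintegral do rewrite mulrDr.
  rewrite (bounded_RintegralD _ (bounded_measurableM bfX bY) (bounded_measurableM bfX bZ)).
  by rewrite (bounded_RintegralD _ bY bZ) mulrDr IHY IHZ.
- have bY := coord_algebra_bounded aY.
  under eq_Rintegral do rewrite mulrCA.
  rewrite (bounded_RintegralZl _ _ (bounded_measurableM bfX bY)).
  by rewrite (bounded_RintegralZl _ _ bY) IHY mulrCA.
Qed.

End IndependentAlgebra.

(** * Trace moments of the sample Gram matrix *)

Section TraceMoments.
Context d (T : measurableType d) (R : realType) (P : probability T R).
Context d' (U : measurableType d').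
Variables (N n : nat) (X : 'I_N -> T -> U) (tau : U -> 'rV[R]_n) (mu : R).
Hypotheses (mX : forall i, measurable_fun setT (X i)) (indX : mutually_independent P X).
Hypothesis mu_gt0 : 0 < mu.
Hypothesis tau_bm : forall j, bounded_measurable (fun x => tau x 0 j).
Hypothesis tau_le : forall x, sqnorm (tau x) <= mu.
Hypothesis tau_iso : forall i j k,
  (\int[P]_w (tau (X i w) 0 j * tau (X i w) 0 k) = (j == k)%:R)%R.

Local Notation v i w := (tau (X i w)).

(** The sum stops before row k, which is therefore independent of it. Rows enter through [tau],
    later the truncation, so that independence is only required of [X]. *)
Definition sample_gram k w : 'M[R]_n := \sum_(i < N | (i < k)%N) (v i w)^T *m v i w.
Local Notation S := sample_gram.

Let before k : {set 'I_N} := [set i : 'I_N | (i < k)%N]%SET.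

Let mx_algebra (J : {set 'I_N}) (Q : T -> 'M[R]_n) :=
  forall j k, coord_algebra X J (fun w => Q w j k).

Lemma Rintegral_qform_independent (J : {set 'I_N}) (Q : T -> 'M[R]_n) i : i \notin J ->
  mx_algebra J Q -> (\int[P]_w qform (Q w) (v i w) = \int[P]_w \tr (Q w))%R.
Proof.
move=> iJ aQ.
pose g j k (x : U) := tau x 0 j * tau x 0 k.
have bg j k : bounded_measurable (g j k) by exact: bounded_measurableM.
pose F j k w := g j k (X i w) * Q w j k.
have bQ j k := coord_algebra_bounded mX (aQ j k).
have bF j k : bounded_measurable (F j k).
  by apply: bounded_measurableM => //; exact: bounded_measurable_rv.
transitivity (\int[P]_w \sum_k \sum_j F j k w)%R.
  apply: eq_Rintegral => w _; rewrite /qform /bform mxE; apply: eq_bigr => k _.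
  rewrite mxE mulr_suml; apply: eq_bigr => j _.
  by rewrite /F /g mxE; ring.
rewrite bounded_Rintegral_sum; last by move=> k; exact: bounded_measurable_sum.
rewrite bounded_Rintegral_sum //; apply: eq_bigr => k _.
rewrite bounded_Rintegral_sum // (bigD1 k) //= big1 ?addr0 => [|j jk].
  by rewrite (coord_algebra_independent mX indX iJ) // tau_iso eqxx mul1r.
by rewrite (coord_algebra_independent mX indX iJ) // tau_iso (negbTE jk) mul0r.
Qed.

Section Shifted.
Variables C sigma : R.
Local Notation K k w := (C%:M + sigma *: S k w).

Lemma sample_gram_algebra k : mx_algebra (before k) (S k).
Proof.
move=> j l; have -> : (fun w => S k w j l) =
    fun w => \sum_(i < N) if (i < k)%N then v i w 0 j * v i w 0 l else 0.
  apply/funext => w; rewrite /sample_gram summxE big_mkcond /=; apply: eq_bigr => i _.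
  by case: ifP => // _; rewrite rank1_mxE.
apply: coord_algebra_sum => i; have [ik|_] := boolP (i < k)%N; last exact: coord_algebra_cst.
apply: (coord_algebra_rv X (i := i) (f := fun x => tau x 0 j * tau x 0 l)).
  by rewrite inE.
exact: bounded_measurableM.
Qed.

Lemma shifted_gram_algebra k q : mx_algebra (before k) (fun w => K k w ^+ q).
Proof.
elim: q => [|q IH] j l.
  by under eq_fun do rewrite expmx0 mxE; exact: coord_algebra_cst.
under eq_fun do rewrite expmxS mxE.
apply: coord_algebra_sum => i; apply: coord_algebraM; last exact: IH.
under eq_fun do rewrite !mxE.
apply: coord_algebraD; first exact: coord_algebra_cst.
by apply: coord_algebraZ; exact: sample_gram_algebra.
Qed.

Lemma mxtrace_shifted_gram_bounded k q : bounded_measurable (fun w => \tr (K k w ^+ q)).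
Proof.
by apply: bounded_measurable_sum => i; exact: (coord_algebra_bounded mX (shifted_gram_algebra k q i i)).
Qed.

Lemma qform_shifted_gram_bounded k q i : bounded_measurable (fun w => qform (K k w ^+ q) (v i w)).
Proof.
have -> : (fun w => qform (K k w ^+ q) (v i w)) =
    fun w => \sum_l (\sum_j v i w 0 j * (K k w ^+ q) j l) * v i w 0 l.
  apply/funext => w; rewrite /qform /bform mxE; apply: eq_bigr => l _.
  by rewrite !mxE.
have bv j : bounded_measurable (fun w => v i w 0 j).
  exact: (bounded_measurable_rv mX i (tau_bm j)).
apply: bounded_measurable_sum => l; apply: bounded_measurableM => //.
apply: bounded_measurable_sum => j; apply: bounded_measurableM => //.
exact: (coord_algebra_bounded mX (shifted_gram_algebra k q j l)).
Qed.

Lemma mxtrace_shifted_gramS k q w :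
  \tr (K k w ^+ q.+1) = C * \tr (K k w ^+ q) + sigma * \tr (K k w ^+ q *m S k w).
Proof.
rewrite expmxSr mulmxDr mxtraceD -scalemxAr mxtraceZ; congr (_ + _).
by rewrite mul_mx_scalar mxtraceZ.
Qed.

End Shifted.

Lemma psdmx_sample_gram k w : psdmx (S k w).
Proof.
rewrite /S; elim/big_ind : _ => [|A B|i _]; last exact: psdmx_gram.
  by have := psdmx_scalar n (lexx (0 : R)); rewrite raddf0.
exact: psdmxD.
Qed.

Lemma sample_gram0 w : S 0 w = 0.
Proof. by rewrite /sample_gram big_pred0. Qed.

Lemma sample_gram_recr (i : 'I_N) w : S i.+1 w = S i w + (v i w)^T *m v i w.
Proof.
rewrite /sample_gram (bigD1 i) //= addrC; congr (_ + _); apply: eq_bigl => j.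
by rewrite ltnS [RHS]ltn_neqAle andbC.
Qed.

(** A crude bound valid for every outcome; it keeps C - S above C - N mu in the lower bound. *)
Lemma qform_sample_gram_le k w x : qform (S k w) x <= N%:R * mu * sqnorm x.
Proof.
have -> : qform (S k w) x = \sum_(i < N | (i < k)%N) (x *m (v i w)^T) 0 0 ^+ 2.
  rewrite /qform /bform /sample_gram mulmx_sumr mulmx_suml summxE; apply: eq_bigr => i _.
  exact: qform_rank1.
apply: (@le_trans _ _ (\sum_(i < N) mu * sqnorm x)); last first.
  by rewrite sumr_const card_ord -[leLHS]mulr_natl mulrA.
rewrite big_mkcond; apply: ler_sum => i _; case: ifP => _; last first.
  by rewrite mulr_ge0 ?sqnorm_ge0 // ltW.
have -> : (x *m (v i w)^T) 0 0 = bform 1%:M x (v i w) by rewrite /bform mulmx1.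
apply: (le_trans (bform_cauchy_schwarz _ _ (psdmx_scalar n ler01))).
by rewrite !qform_scalar !mul1r mulrC ler_wpM2r ?sqnorm_ge0 ?tau_le.
Qed.

Lemma mxtrace_mul_sample_gram_ge0 k w Q : psdmx Q -> 0 <= \tr (Q *m S k w).
Proof.
move=> /psdmxE[_ Q0]; rewrite /sample_gram mulmx_sumr raddf_sum /=; apply: sumr_ge0 => i _.
by rewrite mxtrace_rank1.
Qed.

(** The matrix in the event is l - K with K = C + sigma S. If it fails to be semidefinite, K has a
    Rayleigh quotient of at least l, so tr K^(p+1) >= l^(p+1) and Markov's inequality applies. *)
Lemma spectral_tail C sigma p l : 0 < l -> (forall w, psdmx (C%:M + sigma *: S N w)) ->
  fine (P [set w | ~ psdmx ((l - C)%:M + (- sigma) *: S N w)]) <=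
  (\int[P]_w \tr ((C%:M + sigma *: S N w) ^+ p.+1))%R / l ^+ p.+1.
Proof.
move=> l0 psdK; have bK := mxtrace_shifted_gram_bounded C sigma N p.+1.
have mpsd : measurable [set w | psdmx ((l - C)%:M + (- sigma) *: S N w)].
  apply: measurable_psdmx => [i j|w].
    exact: (coord_algebra_bounded mX (shifted_gram_algebra (l - C) (- sigma) N 1 i j)).1.
  by have [sS _] := psdmx_sample_gram N w; rewrite linearD linearZ /= tr_scalar_mx sS.
apply: le_trans (markov_bounded P _ bK _) => [||w]; last 2 first.
- by rewrite exprn_gt0.
- exact/mxtrace_psd_ge0/psdmxX.
apply: fine_le; rewrite ?fin_num_measure //.
- exact: measurableC.
- exact: bounded_measurable_superlevel.
apply: le_measure; rewrite ?inE.
- exact: measurableC.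
- exact: bounded_measurable_superlevel.
move=> w /= npsd.
have [x x0 xlt] : exists2 x, x != 0 & qform ((l - C)%:M + (- sigma) *: S N w) x < 0.
  apply: not_psdmxP npsd.
  by have [sS _] := psdmx_sample_gram N w; rewrite linearD linearZ /= tr_scalar_mx sS.
apply: (mxtraceX_rayleigh _ l0 (psdK w) x0).
move: xlt; rewrite -subr_gt0 sub0r => xlt; rewrite -subr_ge0; apply/ltW.
suff -> : qform (C%:M + sigma *: S N w) x - l * sqnorm x =
  - qform ((l - C)%:M + (- sigma) *: S N w) x by [].
rewrite /qform !bformD -!/(qform _ _) !qform_scalar !qformZ; ring.
Qed.

(** The iteration starts from tr C^(p+1) = n C^(p+1), the origin of the dimensional factor, and uses
    1 + a <= exp(a) at each row. *)
Lemma trace_moment_iter C sigma p a : (forall k w, psdmx (C%:M + sigma *: S k w)) ->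
  (forall i : 'I_N, (\int[P]_w \tr ((C%:M + sigma *: S i.+1 w) ^+ p.+1) <=
    (1 + a) * \int[P]_w \tr ((C%:M + sigma *: S i w) ^+ p.+1))%R) ->
  (\int[P]_w \tr ((C%:M + sigma *: S N w) ^+ p.+1) <=
    n%:R * C ^+ p.+1 * expR (N%:R * a))%R.
Proof.
move=> psdK step.
suff key k : (k <= N)%N -> (\int[P]_w \tr ((C%:M + sigma *: S k w) ^+ p.+1) <=
    n%:R * C ^+ p.+1 * expR (k%:R * a))%R by exact: key.
elim: k => [|k IH] kN.
  rewrite mul0r expR0 mulr1.
  under eq_Rintegral => w _.
    rewrite sample_gram0 scaler0 addr0.
    have -> : (C%:M : 'M[R]_n) ^+ p.+1 = (C ^+ p.+1)%:M.
      elim: (p.+1) => [|q IHq]; first by rewrite expmx0 expr0.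
      by rewrite expmxS IHq mul_scalar_mx scale_scalar_mx exprS.
    rewrite mxtrace_scalar -mulr_natl; over.
  by rewrite Rintegral_cst1.
apply: (le_trans (step (Ordinal kN))).
have -> : k.+1%:R * a = k%:R * a + a by rewrite -natr1 mulrDl mul1r.
rewrite expRD mulrA [leRHS]mulrC.
apply: (@le_trans _ _ (expR a * \int[P]_w \tr ((C%:M + sigma *: S k w) ^+ p.+1))%R).
  rewrite ler_wpM2r ?expR_ge1Dx //; apply: Rintegral_ge0 => w _.
  exact/mxtrace_psd_ge0/psdmxX.
by rewrite ler_wpM2l ?expR_ge0 // IH // ltnW.
Qed.

Section Upper.
Variables (C : R) (p : nat).
Hypothesis C_gt0 : 0 < C.
Local Notation K k w := (C%:M + 1 *: S k w).
Local Notation a := (p.+1%:R * (1 + mu / C) ^+ p / C).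

Let psdK k w : psdmx (K k w).
Proof. by rewrite scale1r; apply: psdmxD; [exact/psdmx_scalar/ltW|exact: psdmx_sample_gram]. Qed.

Let upper_step (i : 'I_N) :
  (\int[P]_w \tr (K i.+1 w ^+ p.+1) <= (1 + a) * \int[P]_w \tr (K i w ^+ p.+1))%R.
Proof.
pose r := p.+1%:R * (1 + mu / C) ^+ p.
have r0 : 0 <= r by rewrite mulr_ge0 // exprn_ge0 // addr_ge0 // divr_ge0 // ltW.
pose Y w := \tr (K i w ^+ p.+1) + r * qform (K i w ^+ p) (v i w).
have b1 := mxtrace_shifted_gram_bounded C 1 i p.+1; have b2 := qform_shifted_gram_bounded C 1 i p i.
have b3 : bounded_measurable (fun w => r * qform (K i w ^+ p) (v i w)).
  by apply: bounded_measurableM => //; exact: bounded_measurable_cst.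
apply: (@le_trans _ _ (\int[P]_w Y w)%R).
  apply: bounded_le_Rintegral => [||w]; first exact: mxtrace_shifted_gram_bounded.
    exact: bounded_measurableD.
  have -> : K i.+1 w = K i w + (v i w)^T *m v i w.
    by rewrite !scale1r sample_gram_recr addrA.
  have psdKC : psdmx (K i w - C%:M) by rewrite scale1r addrAC subrr add0r; exact: psdmx_sample_gram.
  apply: (le_trans (mxtraceX_rank1_le (v i w) C_gt0 (psdK i w) psdKC p)).
  rewrite lerD2l ler_wpM2r ?qformX_ge0 // ler_wpM2l // lerXn2r ?nnegrE //.
  - by rewrite addr_ge0 // divr_ge0 ?sqnorm_ge0 // ltW.
  - by rewrite addr_ge0 // divr_ge0 // ltW.
  - by rewrite lerD2l ler_pM2r ?invr_gt0 // tau_le.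
rewrite /Y (bounded_RintegralD _ b1 b3) (bounded_RintegralZl _ _ b2).
rewrite (Rintegral_qform_independent (J := before i)) ?inE ?ltnn //; last first.
  exact: shifted_gram_algebra.
(* What remains is C tr K^p <= tr K^(p+1) in expectation, true because K = C + S with S >= 0. *)
rewrite mulrDl mul1r lerD2l -/r -mulrA ler_wpM2l // ler_pdivlMl //.
have b4 := mxtrace_shifted_gram_bounded C 1 i p.
rewrite -(bounded_RintegralZl _ _ b4); apply: bounded_le_Rintegral => // [|w].
  by apply: bounded_measurableM => //; exact: bounded_measurable_cst.
by rewrite [leRHS]mxtrace_shifted_gramS lerDl mul1r; exact/mxtrace_mul_sample_gram_ge0/psdmxX/psdK.
Qed.

Lemma upper_trace_moment :
  (\int[P]_w \tr (K N w ^+ p.+1) <= n%:R * C ^+ p.+1 * expR (N%:R * a))%R.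
Proof.
exact: trace_moment_iter upper_step.
Qed.

Lemma upper_tail b : 0 <= b -> fine (P [set w | ~ psdmx (b%:M - S N w)]) <=
  n%:R * ((C / (C + b)) ^+ p.+1 * expR (N%:R * a)).
Proof.
move=> b0; have Cb0 : 0 < C + b by rewrite ltr_wpDr.
have := spectral_tail p Cb0 (psdK N).
have -> : C + b - C = b by rewrite addrAC subrr add0r.
have -> : [set w | ~ psdmx (b%:M + - 1 *: S N w)] = [set w | ~ psdmx (b%:M - S N w)].
  by apply/seteqP; split=> w /=; rewrite scaleN1r.
move=> /le_trans; apply.
rewrite ler_pdivrMr ?exprn_gt0 //; apply: (le_trans upper_trace_moment).
rewrite exprMn exprVn; set e := expR _; set q := (C + b) ^+ _.
have -> : n%:R * (C ^+ p.+1 * q^-1 * e) * q = n%:R * C ^+ p.+1 * e * (q^-1 * q) by ring.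
by rewrite mulVf ?mulr1 // gt_eqF // exprn_gt0.
Qed.

End Upper.

Section Lower.
Variables (C : R) (p : nat).
Hypothesis C_gt : N%:R * mu < C.
Local Notation K k w := (C%:M + (-1) *: S k w).
Local Notation c := (C - N%:R * mu).
Local Notation a := (p.+1%:R / (1 + mu / c) ^+ p / C).

Let c_gt0 : 0 < c. Proof. by rewrite subr_gt0. Qed.
Let C_gt0 : 0 < C. Proof. by rewrite (le_lt_trans _ C_gt) // mulr_ge0 // ltW. Qed.

Let psdKc k w : psdmx (K k w - c%:M).
Proof.
apply/psdmxE; have [sS _] := psdmx_sample_gram k w.
split; first by rewrite linearB linearD linearZ /= !tr_scalar_mx sS.
move=> x; rewrite scaleN1r /qform !bformB -!/(qform _ _) !qform_scalar.
by rewrite subr_ge0 mulrBl lerD2l lerN2 qform_sample_gram_le.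
Qed.

Let psdK k w : psdmx (K k w).
Proof.
by have := psdmxD (psdKc k w) (psdmx_scalar n (ltW c_gt0)); rewrite subrK.
Qed.

Let lower_step (i : 'I_N) :
  (\int[P]_w \tr (K i.+1 w ^+ p.+1) <= (1 - a) * \int[P]_w \tr (K i w ^+ p.+1))%R.
Proof.
pose r := p.+1%:R / (1 + mu / c) ^+ p.
have mc : 0 < 1 + mu / c by rewrite addr_gt0 // divr_gt0.
have r0 : 0 <= r by rewrite divr_ge0 // exprn_ge0 // ltW.
pose Y w := \tr (K i w ^+ p.+1) - r * qform (K i w ^+ p) (v i w).
have b1 := mxtrace_shifted_gram_bounded C (-1) i p.+1; have b2 := qform_shifted_gram_bounded C (-1) i p i.
have b4 := mxtrace_shifted_gram_bounded C (-1) i p.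
have b3 : bounded_measurable (fun w => r * qform (K i w ^+ p) (v i w)).
  by apply: bounded_measurableM => //; exact: bounded_measurable_cst.
apply: (@le_trans _ _ (\int[P]_w Y w)%R).
  apply: bounded_le_Rintegral => [||w]; first exact: mxtrace_shifted_gram_bounded.
    exact: bounded_measurableB.
  (* The rank-one lemmas are applied upward from the new matrix [K i.+1] to the old one [K i]; only
     the latter is independent of row i. *)
  have KE : K i w = K i.+1 w + (v i w)^T *m v i w.
    by rewrite !scaleN1r sample_gram_recr opprD addrA subrK.
  have hge := mxtraceX_rank1_ge (v i w) (psdK i.+1 w) p.
  have hle := qformX_rank1_le (v i w) c_gt0 (psdK i.+1 w) (psdKc i.+1 w) p.
  rewrite -KE in hge hle; rewrite /Y lerBrDr; apply: le_trans hge.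
  rewrite lerD2l /r -mulrA ler_wpM2l // ler_pdivrMl ?exprn_gt0 //.
  apply: (le_trans hle); rewrite ler_wpM2r ?qformX_ge0 // lerXn2r ?nnegrE //.
  - by rewrite addr_ge0 // divr_ge0 ?sqnorm_ge0 // ltW.
  - exact: ltW.
  - by rewrite lerD2l ler_pM2r ?invr_gt0 // tau_le.
rewrite /Y (bounded_RintegralB _ b1 b3) (bounded_RintegralZl _ _ b2).
rewrite (Rintegral_qform_independent (J := before i)) ?inE ?ltnn //; last first.
  exact: shifted_gram_algebra.
(* Now K = C - S, so the needed inequality is reversed: tr K^(p+1) <= C tr K^p. *)
rewrite mulrBl mul1r lerD2l lerN2 -/r -mulrA ler_wpM2l // ler_pdivrMl //.
rewrite -(bounded_RintegralZl _ _ b4); apply: bounded_le_Rintegral => // [|w].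
  by apply: bounded_measurableM => //; exact: bounded_measurable_cst.
by rewrite [leLHS]mxtrace_shifted_gramS mulN1r gerBl; exact/mxtrace_mul_sample_gram_ge0/psdmxX/psdK.
Qed.

Lemma lower_trace_moment :
  (\int[P]_w \tr (K N w ^+ p.+1) <= n%:R * C ^+ p.+1 * expR (- (N%:R * a)))%R.
Proof.
have := @trace_moment_iter C (-1) p (- a) psdK; rewrite mulrN; apply => i.
exact: lower_step.
Qed.

Lemma lower_tail b : b < C -> fine (P [set w | ~ psdmx (S N w - b%:M)]) <=
  n%:R * ((C / (C - b)) ^+ p.+1 * expR (- (N%:R * a))).
Proof.
move=> bC; have Cb0 : 0 < C - b by rewrite subr_gt0.
have := spectral_tail p Cb0 (psdK N).
have -> : C - b - C = - b by rewrite addrAC subrr add0r.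
rewrite opprK.
have -> : [set w | ~ psdmx ((- b)%:M + 1 *: S N w)] = [set w | ~ psdmx (S N w - b%:M)].
  by apply/seteqP; split=> w /=; rewrite scale1r addrC raddfN.
move=> /le_trans; apply.
rewrite ler_pdivrMr ?exprn_gt0 //; apply: (le_trans lower_trace_moment).
rewrite [(C / (C - b)) ^+ _]exprMn exprVn; set e := expR _; set q := (C - b) ^+ _.
have -> : n%:R * (C ^+ p.+1 * q^-1 * e) * q = n%:R * C ^+ p.+1 * e * (q^-1 * q) by ring.
by rewrite mulVf ?mulr1 // gt_eqF // exprn_gt0.
Qed.

End Lower.

End TraceMoments.

(** * Choice of the exponent and of the shift *)

Section ExponentBounds.
Variable R : realType.
Implicit Types s r t x : R.

Lemma expR_le_inv x : x < 1 -> expR x <= (1 - x)^-1.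
Proof.
move=> x1; rewrite -[x]opprK expRN lef_pV2 ?posrE ?expR_gt0 ?opprK ?subr_gt0 //.
exact: expR_ge1Dx.
Qed.

Lemma expR_le_half x : 0 <= x <= 2^-1 -> expR x <= 1 + 2 * x.
Proof.
move=> /andP[x0 x1]; apply: (le_trans (expR_le_inv _)); first lra.
rewrite -[leLHS]mul1r ler_pdivrMr; nra.
Qed.

Lemma exprn_le_expR x n : -1 <= x -> (1 + x) ^+ n <= expR (n%:R * x).
Proof.
move=> x1; rewrite expRM_natl lerXn2r ?nnegrE ?expR_ge0 ?expR_ge1Dx //.
by rewrite -lerBlDl sub0r.
Qed.

(** Since p is an integer, C is adjusted to it, so that theta = (p + 1) / C holds exactly with C as
    large as desired. *)
Lemma degree_exists (theta C0 : R) : 0 < theta ->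
  exists p C, [/\ 0 < C, C0 <= C & p.+1%:R = theta * C].
Proof.
move=> th0; exists (Num.truncn (theta * C0)), ((Num.truncn (theta * C0)).+1%:R / theta).
split; first by rewrite divr_gt0.
  by rewrite ler_pdivlMr // mulrC ltW // truncnS_gt.
by rewrite [RHS]mulrC divfK // gt_eqF.
Qed.

(** The left side is the exponent reached as p grows. Keeping theta r^2 <= 1/2 allows exp(x) <= 1 +
    2 x. *)
Lemma upper_exponent s r t : 0 < s -> 0 < r -> 0 < t -> exists2 theta, 0 < theta &
  s ^+ 2 * theta * expR (theta * r ^+ 2) - theta * (s + t * r) ^+ 2 <= - (t ^+ 2 / 4).
Proof.
move=> s0 r0 t0.
have key theta : 0 < theta -> theta * r ^+ 2 <= 2^-1 ->
    s ^+ 2 * theta * expR (theta * r ^+ 2) <= s ^+ 2 * theta * (1 + 2 * (theta * r ^+ 2)).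
  move=> th0 th1; rewrite ler_wpM2l ?expR_le_half ?th1 ?andbT //.
    by rewrite mulr_ge0 ?exprn_ge0 // ltW.
  by rewrite mulr_ge0 ?exprn_ge0 // ltW.
have [trs|trs] := leP (t * r) s.
  (* Minimiser of 2 s^2 r^2 theta^2 - 2 s t r theta; here theta r^2 = t r / (2 s) <= 1/2. *)
  pose theta := t / (2 * s * r).
  have th0 : 0 < theta by rewrite divr_gt0 ?mulr_gt0.
  have tE : t = 2 * s * r * theta by rewrite /theta mulrC divfK // gt_eqF ?mulr_gt0.
  exists theta => //; apply: (le_trans (lerB (key _ th0 _) (lexx _))).
    rewrite tE in trs; rewrite -(ler_pM2r s0); nra.
  rewrite tE; have := mulr_ge0 (ltW th0) (sqr_ge0 (t * r)); rewrite tE.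
  nra.
(* For large t, the largest theta with theta r^2 <= 1/2. *)
pose theta := (2 * r ^+ 2)^-1.
have r20 : 0 < r ^+ 2 by rewrite exprn_gt0.
have th0 : 0 < theta by rewrite invr_gt0 mulr_gt0.
have thE : theta * r ^+ 2 = 2^-1 by rewrite /theta; field; rewrite gt_eqF.
exists theta => //; apply: (le_trans (lerB (key _ th0 _) (lexx _))).
  by rewrite thE.
rewrite thE.
have -> : s ^+ 2 * theta * (1 + 2 / 2) - theta * (s + t * r) ^+ 2 =
   theta * (s ^+ 2 - 2 * s * (t * r)) - t ^+ 2 * (theta * r ^+ 2) by field.
rewrite thE; have : theta * (s ^+ 2 - 2 * s * (t * r)) <= 0.
  by rewrite mulr_ge0_le0 ?(ltW th0) //; nra.
nra.
Qed.

Lemma upper_parameters s r t : 0 < s -> 0 < r -> 0 < t -> exists p C, 0 < C /\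
  (C / (C + (s + t * r) ^+ 2)) ^+ p.+1 *
    expR (s ^+ 2 * (p.+1%:R * (1 + r ^+ 2 / C) ^+ p / C)) <= expR (- (t ^+ 2 / 8)).
Proof.
move=> s0 r0 t0; have [theta th0 hE] := upper_exponent s0 r0 t0.
set b := (s + t * r) ^+ 2 in hE *; have b0 : 0 <= b by rewrite sqr_ge0.
have t20 : 0 < t ^+ 2 by rewrite exprn_gt0.
(* Replacing b / (C + b) by b / C costs at most theta b^2 / C; this C brings it below t^2/8, half of
   the available t^2/4. *)
have [p [C [C0 CC pE]]] := degree_exists (8 * (theta * b ^+ 2) / t ^+ 2) th0.
exists p, C; split => //.
have Cb0 : 0 < C + b by rewrite ltr_wpDr.
have -> : C / (C + b) = 1 + - (b / (C + b)) by field; rewrite gt_eqF.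
have hb : b / (C + b) <= 1 by rewrite ler_pdivrMr // mul1r lerDr ltW.
apply: (@le_trans _ _ (expR (p.+1%:R * - (b / (C + b))) *
    expR (s ^+ 2 * (theta * expR (theta * r ^+ 2))))).
  apply: ler_pM; rewrite ?expR_ge0 ?exprn_ge0 //; first lra.
    by apply: exprn_le_expR; lra.
  rewrite ler_expR ler_wpM2l ?sqr_ge0 //.
  have -> : p.+1%:R * (1 + r ^+ 2 / C) ^+ p / C = theta * (1 + r ^+ 2 / C) ^+ p.
    by rewrite pE; field; rewrite gt_eqF.
  rewrite ler_wpM2l ?(ltW th0) //.
  have rC : 0 <= r ^+ 2 / C by rewrite divr_ge0 ?sqr_ge0 ?ltW.
  apply: (le_trans (exprn_le_expR _ _)); first lra.
  rewrite ler_expR; apply: (@le_trans _ _ (p.+1%:R * (r ^+ 2 / C))).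
    by rewrite ler_wpM2r // ler_nat.
  by rewrite pE le_eqVlt; apply/orP; left; apply/eqP; field; rewrite gt_eqF.
rewrite -expRD ler_expR.
have hq : theta * b - theta * b ^+ 2 / C <= p.+1%:R * (b / (C + b)).
  rewrite pE -subr_ge0.
  have -> : theta * C * (b / (C + b)) - (theta * b - theta * b ^+ 2 / C) =
      theta * b ^+ 3 / (C * (C + b)) by field; rewrite !gt_eqF.
  have [thW CW CbW] := And3 (ltW th0) (ltW C0) (ltW Cb0).
  by apply: divr_ge0; apply: mulr_ge0 => //; exact: exprn_ge0.
have hC : theta * b ^+ 2 / C <= t ^+ 2 / 8.
  rewrite ler_pdivrMr //; rewrite ler_pdivrMr // in CC; lra.
rewrite mulrN mulrA; lra.
Qed.

Lemma lower_parameters s r t : 0 < s -> 1 <= r -> 0 < t -> t * r < s ->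
  exists p C, [/\ s ^+ 2 * r ^+ 2 < C, (s - t * r) ^+ 2 < C &
  (C / (C - (s - t * r) ^+ 2)) ^+ p.+1 *
    expR (- (s ^+ 2 * (p.+1%:R / (1 + r ^+ 2 / (C - s ^+ 2 * r ^+ 2)) ^+ p / C)))
    <= expR (- (t ^+ 2 / 8))].
Proof.
move=> s0 r1 t0 trs; have r0 : 0 < r by rewrite (lt_le_trans _ r1).
(* With this theta the limiting exponent -theta s t r + s^2 r^2 theta^2 equals -t^2/4. *)
have [theta th0 tE] : exists2 theta, 0 < theta & t = 2 * s * r * theta.
  exists (t / (2 * s * r)); first by rewrite divr_gt0 ?mulr_gt0.
  by rewrite [RHS]mulrC divfK // gt_eqF ?mulr_gt0.
(* The tolerated relative error in C / (C - M): its main cost theta s^2 kappa is exactly t^2/8. *)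
pose kappa := theta * r ^+ 2 / 2.
have k0 : 0 < kappa by rewrite divr_gt0 ?mulr_gt0 ?exprn_gt0.
set a := (s - t * r) ^+ 2; have a0 : 0 <= a by rewrite sqr_ge0.
set M := s ^+ 2 * r ^+ 2.
have M0 : 0 < M by rewrite mulr_gt0 ?exprn_gt0.
have str : (t * r) ^+ 2 <= s * (t * r).
  by rewrite expr2 ler_wpM2r ?mulr_ge0 ?ltW.
have aE : a <= s ^+ 2 - s * (t * r).
  have -> : a = s ^+ 2 - 2 * (s * (t * r)) + (t * r) ^+ 2 by rewrite /a; ring.
  lra.
(* Here [1 <= r] enters: a <= s^2 <= s^2 r^2, so C > M also exceeds a. *)
have aM : a <= M.
  apply: (le_trans aE); apply: (@le_trans _ _ (s ^+ 2)).
    by rewrite gerBl !mulr_ge0 ?ltW.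
  by rewrite -[leLHS]mulr1 ler_wpM2l ?sqr_ge0 // expr_ge1 // ltW.
(* C >= M (1 + kappa) / kappa is equivalent to C / (C - M) <= 1 + kappa. *)
have [p [C [C0 CC pE]]] := degree_exists (M * (1 + kappa) / kappa) th0.
have CM : M * (1 + kappa) <= kappa * C by move: CC; rewrite ler_pdivrMr // [C * _]mulrC.
have MC : M < C by nra.
exists p, C; split => //; first exact: le_lt_trans MC.
have CM0 : 0 < C - M by rewrite subr_gt0.
have Ca0 : 0 < C - a by rewrite subr_gt0 (le_lt_trans aM).
have hk : C / (C - M) <= 1 + kappa by rewrite ler_pdivrMr //; nra.
have -> : C / (C - a) = 1 + a / (C - a) by field; rewrite gt_eqF.
have rM0 : 0 <= r ^+ 2 / (C - M) by rewrite divr_ge0 ?sqr_ge0 ?ltW.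
apply: (@le_trans _ _ (expR (p.+1%:R * (a / (C - a))) *
    expR (- (s ^+ 2 * (theta * (1 - theta * r ^+ 2 * (1 + kappa))))))).
  apply: ler_pM; rewrite ?expR_ge0 ?exprn_ge0 //.
  - by rewrite addr_ge0 // divr_ge0 // ltW.
  - by apply: exprn_le_expR; rewrite (@le_trans _ _ 0) // divr_ge0 // ltW.
  rewrite ler_expR lerN2 ler_wpM2l ?sqr_ge0 //.
  have -> : p.+1%:R / (1 + r ^+ 2 / (C - M)) ^+ p / C =
      theta * ((1 + r ^+ 2 / (C - M)) ^+ p)^-1.
    by rewrite pE mulrAC mulfK // gt_eqF.
  rewrite ler_wpM2l ?(ltW th0) //.
  have h1 := exprn_le_expR p (le_trans (lerN10 R) rM0).
  apply: (@le_trans _ _ (expR (- (p%:R * (r ^+ 2 / (C - M)))))); last first.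
    by rewrite expRN lef_pV2 ?posrE ?expR_gt0 // exprn_gt0 //; lra.
  apply: le_trans (expR_ge1Dx _); rewrite lerD2l lerN2.
  apply: (@le_trans _ _ (p.+1%:R * (r ^+ 2 / (C - M)))).
    by rewrite ler_wpM2r // ler_nat.
  have -> : p.+1%:R * (r ^+ 2 / (C - M)) = theta * r ^+ 2 * (C / (C - M)).
    by rewrite pE; field; rewrite gt_eqF.
  by rewrite ler_wpM2l // mulr_ge0 ?sqr_ge0 ?ltW.
rewrite -expRD ler_expR.
have h2 : p.+1%:R * (a / (C - a)) <= theta * a * (1 + kappa).
  have -> : p.+1%:R * (a / (C - a)) = theta * a * (C / (C - a)).
    by rewrite pE; field; rewrite gt_eqF.
  apply: ler_wpM2l; first by apply: mulr_ge0 => //; exact: ltW.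
  apply: le_trans hk.
  by rewrite ler_pM2l // lef_pV2 ?posrE // lerD2l lerN2.
have h3 : theta * a * (1 + kappa) <= theta * (s ^+ 2 - s * (t * r)) * (1 + kappa).
  by rewrite ler_wpM2r ?ler_wpM2l ?addr_ge0 // ltW.
have h4 : theta * (s ^+ 2 - s * (t * r)) * (1 + kappa) -
     s ^+ 2 * (theta * (1 - theta * r ^+ 2 * (1 + kappa))) =
     - (t ^+ 2 / 8) - kappa * theta * (s * (t * r)) / 2.
  by rewrite tE /kappa; field.
have h5 : 0 <= kappa * theta * (s * (t * r)) / 2.
  by rewrite !mulr_ge0 ?invr_ge0 // ltW.
lra.
Qed.

End ExponentBounds.

Section GramMatrixTails.
Context d (T : measurableType d) (R : realType) (P : probability T R).
Context d' (U : measurableType d').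
Variables (N n : nat) (X : 'I_N -> T -> U) (tau : U -> 'rV[R]_n) (r t : R).
Hypotheses (mX : forall i, measurable_fun setT (X i)) (indX : mutually_independent P X).
Hypotheses (N_gt0 : (0 < N)%N) (r_ge1 : 1 <= r) (t_gt0 : 0 < t).
Hypothesis tau_bm : forall j, bounded_measurable (fun x => tau x 0 j).
Hypothesis tau_le : forall x, sqnorm (tau x) <= r ^+ 2.
Hypothesis tau_iso : forall i j k,
  (\int[P]_w (tau (X i w) 0 j * tau (X i w) 0 k) = (j == k)%:R)%R.
Local Notation s := (Num.sqrt N%:R : R).
Local Notation S := (sample_gram X tau N).

Let s_gt0 : 0 < s. Proof. by rewrite sqrtr_gt0 ltr0n. Qed.
Let r_gt0 : 0 < r. Proof. exact: lt_le_trans r_ge1. Qed.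
Let r2_gt0 : 0 < r ^+ 2. Proof. by rewrite exprn_gt0. Qed.
Let sE : s ^+ 2 = N%:R. Proof. by rewrite sqr_sqrtr. Qed.

Lemma gram_upper_tail :
  fine (P [set w | ~ psdmx (((s + t * r) ^+ 2)%:M - S w)]) <= n%:R * expR (- (t ^+ 2 / 8)).
Proof.
have [p [C [C0 hE]]] := upper_parameters s_gt0 r_gt0 t_gt0.
apply: (le_trans (upper_tail mX indX r2_gt0 tau_bm tau_le tau_iso p C0 (sqr_ge0 _))).
by rewrite ler_wpM2l // -{2}sE.
Qed.

Lemma gram_lower_tail : t * r < s ->
  fine (P [set w | ~ psdmx (S w - ((s - t * r) ^+ 2)%:M)]) <= n%:R * expR (- (t ^+ 2 / 8)).
Proof.
move=> trs; have [p [C [MC aC hE]]] := lower_parameters s_gt0 r_ge1 t_gt0 trs.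
rewrite sE in MC hE.
apply: (le_trans (lower_tail mX indX r2_gt0 tau_bm tau_le tau_iso p MC aC)).
by rewrite ler_wpM2l.
Qed.

End GramMatrixTails.

(** * Truncated rows *)

Section Truncation.
Variables (R : realType) (n : nat) (r : R).
Hypothesis r_ge0 : 0 <= r.

(* The rows are bounded only almost surely. *)
Definition truncate (x : borel_rV R n) : 'rV[R]_n :=
  if sqnorm x <= r ^+ 2 then x else 0.

Lemma sqnorm_truncate x : sqnorm (truncate x) <= r ^+ 2.
Proof.
rewrite /truncate; case: ifP => // _.
by have /eqP -> : sqnorm (0 : 'rV[R]_n) == 0; rewrite ?sqnorm_eq0 ?sqr_ge0.
Qed.

Lemma sqr_coord_le (x : 'rV[R]_n) j : x 0 j ^+ 2 <= sqnorm x.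
Proof.
by rewrite /sqnorm (bigD1 j) //= lerDl; apply: sumr_ge0 => i _; rewrite sqr_ge0.
Qed.

Lemma measurable_sqnorm : measurable_fun [set: borel_rV R n] (fun x : borel_rV R n => sqnorm x).
Proof.
by apply: measurable_sum => j; apply: measurable_funX; exact: measurable_coord.
Qed.

Lemma truncate_bounded_measurable j :
  bounded_measurable (fun x : borel_rV R n => truncate x 0 j).
Proof.
split; last first.
  exists r => x; rewrite -(ler_pXn2r (n := 2)) ?nnegrE // real_normK ?num_real //.
  exact: le_trans (sqr_coord_le _ _) (sqnorm_truncate x).
have -> : (fun x : borel_rV R n => truncate x 0 j) =
    fun x => if sqnorm x <= r ^+ 2 then (x : 'rV[R]_n) 0 j else 0.
  by apply/funext => x; rewrite /truncate; case: ifP; rewrite ?mxE.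
apply: measurable_fun_ifT => //; last exact: measurable_coord.
exact: measurable_fun_ler measurable_sqnorm _.
Qed.

Lemma truncate_id x : norm2 x <= r -> truncate x = x.
Proof.
rewrite /truncate /norm2 -/(sqnorm x) => xr.
suff -> : sqnorm x <= r ^+ 2 by [].
by rewrite -[leLHS]sqr_sqrtr ?sqnorm_ge0 // ler_pXn2r ?nnegrE ?sqrtr_ge0.
Qed.

End Truncation.

Lemma trmx_mul_rows (R : realType) (N n : nat) (A : 'M[R]_(N, n)) :
  A^T *m A = \sum_(i < N) (row i A)^T *m row i A.
Proof.
apply/matrixP => j k; rewrite summxE mxE; apply: eq_bigr => i _.
by rewrite !mxE big_ord1 !mxE.
Qed.

(** * Tails of the extreme singular values *)

(** Outside a measurable null set Z the implication holds, so E is contained in the union of F and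
    Z. *)
Lemma le_measure_ae d (T : measurableType d) (R : realType) (P : probability T R)
    (E F : set T) :
  measurable E -> measurable F -> {ae P, forall w, E w -> F w} -> (P E <= P F)%E.
Proof.
move=> mE mF [Z [mZ PZ EFZ]]; rewrite -(measureU0 mF mZ PZ).
apply: le_measure; rewrite ?inE //; first exact: measurableU.
move=> w Ew; have [Fw|nFw] := pselect (F w); first by left.
by right; apply: EFZ => /= h; exact/nFw/h.
Qed.

Section SingularValueTails.
Context d (T : measurableType d) (R : realType) (P : probability T R).
Variables (N n : nat) (A : T -> 'M[R]_(N, n)) (m : R).
Hypotheses (N_gt0 : (0 < N)%N) (n_gt0 : (0 < n)%N).
Hypothesis mA : forall i : 'I_N, random_vector (fun w => row i (A w) : borel_rV R n).
Hypothesis indA : mutually_independent P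
  (fun (i : 'I_N) w => row i (A w) : borel_rV R n).
Hypothesis isoA : forall i : 'I_N, isotropic P (fun w => row i (A w)).
Hypothesis A_le : forall i : 'I_N,
  {ae P, forall w, norm2 (row i (A w)) <= Num.sqrt m}.
Local Notation r := (Num.sqrt m).
Local Notation s := (Num.sqrt N%:R : R).
Local Notation X := (fun (i : 'I_N) w => row i (A w) : borel_rV R n).
Local Notation S := (sample_gram X (@truncate R n r) N).

Let measurable_entry i j : measurable_fun setT (fun w => A w i j).
Proof.
have -> : (fun w => A w i j) = fun w => row i (A w) 0 j.
  by apply/funext => w; rewrite mxE.
exact: (measurableT_comp (measurable_coord j) (mA i)).
Qed.

Let ae_truncate i : {ae P, forall w, truncate r (row i (A w)) = row i (A w)}.
Proof. apply: filterS (A_le i) => w h; exact: (truncate_id (sqrtr_ge0 _) h). Qed.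

Let truncate_isotropic i j k :
  (\int[P]_w (truncate r (row i (A w)) 0 j * truncate r (row i (A w)) 0 k) = (j == k)%:R)%R.
Proof.
have := isoA i j k; rewrite unlock mxE => isoE.
have -> : (j == k)%:R = fine ((j == k)%:R)%:E :> R by [].
rewrite -isoE; congr fine; apply: ae_eq_integral => //.
- apply/measurable_EFinP; have bX l := @truncate_bounded_measurable R n r (sqrtr_ge0 m) l.
  exact: measurable_funM (bounded_measurable_rv mA i (bX j)).1
    (bounded_measurable_rv mA i (bX k)).1.
- apply/measurable_EFinP.
  have -> : (fun w => ((row i (A w))^T *m row i (A w)) j k) = fun w => A w i j * A w i k.
    by apply/funext => w; rewrite rank1_mxE !mxE.
  exact: measurable_funM.
apply: filterS (ae_truncate i) => w -> _.
by rewrite rank1_mxE.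
Qed.

(** A single coordinate of a single row has second moment 1 and square at most m. *)
Let sqrt_m_ge1 : 1 <= r.
Proof.
pose i0 := Ordinal N_gt0; pose j0 := Ordinal n_gt0.
have bX := @truncate_bounded_measurable R n r (sqrtr_ge0 m) j0.
have bY := bounded_measurable_rv mA i0 (bounded_measurableM bX bX).
rewrite -(@ler_pXn2r _ 2) ?nnegrE ?sqrtr_ge0 // expr1n.
have <- : (\int[P]_w (truncate r (row i0 (A w)) 0 j0 * truncate r (row i0 (A w)) 0 j0) = 1)%R.
  by rewrite truncate_isotropic eqxx.
rewrite -[leRHS](Rintegral_cst1 P).
apply: bounded_le_Rintegral => // [|w]; first exact: bounded_measurable_cst.
rewrite /= -expr2; apply: (le_trans (sqr_coord_le _ _)).
exact: sqnorm_truncate.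
Qed.

Let ae_gram : {ae P, forall w, (A w)^T *m A w = S w}.
Proof.
have : {ae P, forall w, forall i : 'I_N, truncate r (row i (A w)) = row i (A w)}.
  exact: filter_forall.
apply: filterS => w wE; rewrite trmx_mul_rows /sample_gram.
by apply: eq_big => [i|i _]; rewrite ?ltn_ord // wE.
Qed.

Let measurable_gram c sigma : measurable [set w | psdmx (c%:M + sigma *: ((A w)^T *m A w))].
Proof.
apply: measurable_psdmx => [i j|w].
  have -> : (fun w => (c%:M + sigma *: ((A w)^T *m A w)) i j) =
      fun w => c *+ (i == j) + sigma * \sum_k A w k i * A w k j.
    apply/funext => w; rewrite !mxE; congr (_ + _ * _).
    by apply: eq_bigr => k _; rewrite mxE.
  apply: measurable_funD => //; apply: measurable_funM => //.
  by apply: measurable_sum => k; exact: measurable_funM.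
by rewrite linearD linearZ /= tr_scalar_mx trmx_mul trmxK.
Qed.

Let measurable_truncated_gram c sigma : measurable [set w | psdmx (c%:M + sigma *: S w)].
Proof.
have tbm := @truncate_bounded_measurable R n r (sqrtr_ge0 m).
apply: measurable_psdmx => [i j|w].
  exact: (coord_algebra_bounded mA (shifted_gram_algebra X tbm c sigma N 1 i j)).1.
by have [sS _] := psdmx_sample_gram X (@truncate R n r) N w; rewrite linearD linearZ /= tr_scalar_mx sS.
Qed.

Let setE (F : T -> 'M[R]_n) (G : T -> 'M[R]_n) : F =1 G ->
  [set w | psdmx (F w)] = [set w | psdmx (G w)].
Proof. by move=> FG; apply/seteqP; split=> w /=; rewrite FG. Qed.

Let tail_ae (F G : T -> 'M[R]_n) x :
  measurable [set w | psdmx (F w)] -> measurable [set w | psdmx (G w)] ->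
  {ae P, forall w, F w = G w} -> fine (P [set w | ~ psdmx (G w)]) <= x ->
  (P (~` [set w | psdmx (F w)]) <= x%:E)%E.
Proof.
move=> mF mG FG Gx; apply: (@le_trans _ _ (P (~` [set w | psdmx (G w)]))).
  apply: le_measure_ae; [exact: measurableC|exact: measurableC|].
  by apply: filterS FG => w /= ->.
by rewrite -[leLHS]fineK ?lee_fin // fin_num_measure //; exact: measurableC.
Qed.

Variable t : R.
Hypothesis t_gt0 : 0 < t.
Local Notation bound := (n%:R * expR (- (t ^+ 2 / 8))).

Lemma s_max_tail :
  measurable [set w | s_max (A w) <= s + t * r] /\
  (P (~` [set w | (s_max (A w) <= s + t * r)%R]) <= bound%:E)%E.
Proof.
have b0 : 0 <= s + t * r by rewrite addr_ge0 ?mulr_ge0 ?sqrtr_ge0 // ltW.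
have -> : [set w | s_max (A w) <= s + t * r] =
    [set w | psdmx (((s + t * r) ^+ 2)%:M - (A w)^T *m A w)].
  by apply/seteqP; split=> w /(s_max_leP (A w) n_gt0 b0).
have m1 : measurable [set w | psdmx (((s + t * r) ^+ 2)%:M - (A w)^T *m A w)].
  rewrite (setE (G := fun w => ((s + t * r) ^+ 2)%:M + -1 *: ((A w)^T *m A w))) // => w.
  by rewrite scaleN1r.
split=> //; apply: (tail_ae (G := fun w => ((s + t * r) ^+ 2)%:M - S w)) => //.
- rewrite (setE (G := fun w => ((s + t * r) ^+ 2)%:M + -1 *: S w)) // => w.
  by rewrite scaleN1r.
- by apply: filterS ae_gram => w ->.
apply: gram_upper_tail => //; first exact: truncate_bounded_measurable (sqrtr_ge0 m).
exact: sqnorm_truncate.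
Qed.

Lemma s_min_tail :
  measurable [set w | s - t * r <= s_min (A w)] /\
  (P (~` [set w | (s - t * r <= s_min (A w))%R]) <= bound%:E)%E.
Proof.
(* Passing to squares needs s - t r >= 0; otherwise the bound follows from [s_min_ge0]. *)
have [trs|trs] := leP s (t * r).
  have -> : [set w | s - t * r <= s_min (A w)] = setT.
    apply/seteqP; split=> w //= _; apply: (le_trans _ (s_min_ge0 (A w) n_gt0)).
    by rewrite subr_le0.
  by rewrite setCT measure0; split=> //; rewrite lee_fin mulr_ge0 ?expR_ge0.
have a0 : 0 <= s - t * r by rewrite subr_ge0 ltW.
have -> : [set w | s - t * r <= s_min (A w)] =
    [set w | psdmx ((A w)^T *m A w - ((s - t * r) ^+ 2)%:M)].
  by apply/seteqP; split=> w /(s_min_geP (A w) n_gt0 a0).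
have m1 : measurable [set w | psdmx ((A w)^T *m A w - ((s - t * r) ^+ 2)%:M)].
  rewrite (setE (G := fun w => (- (s - t * r) ^+ 2)%:M + 1 *: ((A w)^T *m A w))) // => w.
  by rewrite scale1r addrC raddfN.
split=> //; apply: (tail_ae (G := fun w => S w - ((s - t * r) ^+ 2)%:M)) => //.
- rewrite (setE (G := fun w => (- (s - t * r) ^+ 2)%:M + 1 *: S w)) // => w.
  by rewrite scale1r addrC raddfN.
- by apply: filterS ae_gram => w ->.
apply: gram_lower_tail => //; first exact: truncate_bounded_measurable (sqrtr_ge0 m).
exact: sqnorm_truncate.
Qed.

End SingularValueTails.

Theorem theorem5p41 (R : realType) :
  exists2 c : R, 0 < c &
    forall (d : measure_display) (T : measurableType d) (P : probability T R)
      (N n : nat) (A : T -> 'M[R]_(N, n)) (m : R),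
    (0 < N)%N -> (0 < n)%N ->
    (forall i : 'I_N, random_vector (fun w => row i (A w) : borel_rV R n)) ->
    mutually_independent P
      (fun (i : 'I_N) w => row i (A w) : borel_rV R n) ->
    (forall i : 'I_N, isotropic P (fun w => row i (A w))) ->
    (forall i : 'I_N,
       {ae P, forall w, norm2 (row i (A w)) <= Num.sqrt m}) ->
    forall t : R, 0 <= t ->
      ((1 - 2 * n%:R * expR (- (c * t ^+ 2)))%:E <=
        P [set w | [/\ Num.sqrt N%:R - t * Num.sqrt m <= s_min (A w),
                       s_min (A w) <= s_max (A w) &
                       s_max (A w) <= Num.sqrt N%:R + t * Num.sqrt m]%R])%E.
Proof.
exists 8^-1; first by rewrite invr_gt0.
move=> d T P N n A m N_gt0 n_gt0 mA indA isoA A_le t.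
(* At t = 0 the claimed probability is 1 - 2 n < 0; the choice of theta in the tail bounds requires
   t > 0. *)
rewrite le_eqVlt => /predU1P[<-|t_gt0].
  rewrite expr0n mulr0 oppr0 expR0 mulr1; apply: le_trans (measure_ge0 _ _).
  have : 1 <= n%:R :> R by rewrite ler1n.
  by rewrite lee_fin; lra.
have [mmin Pmin] := s_min_tail N_gt0 n_gt0 mA indA isoA A_le t_gt0.
have [mmax Pmax] := s_max_tail N_gt0 n_gt0 mA indA isoA A_le t_gt0.
set E := [set w | [/\ _, _ & _]].
set E1 := [set w | _] in mmin Pmin; set E2 := [set w | _] in mmax Pmax.
have EE : E = E1 `&` E2.
  by apply/seteqP; split=> w [] //=; split => //; exact: s_min_le_s_max.
(* Union bound over the two tails, each at most n exp(-t^2/8); this is the factor 2 n. *)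
have PC : (P (~` E) <= (2 * n%:R * expR (- (8^-1 * t ^+ 2)))%:E)%E.
  rewrite EE setCI; apply: (le_trans (measureU2 _ _ _)); [exact: measurableC..|].
  apply: (le_trans (leeD Pmin Pmax)); rewrite -EFinD lee_fin.
  by rewrite [8^-1 * _]mulrC; lra.
have mE : measurable E by rewrite EE; exact: measurableI.
rewrite -[E]setCK probability_setC; last exact: measurableC.
by rewrite EFinB leeB.
Qed.
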